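(* Let $0<q<1$ and $d\ge1$. The function $$f_q(s_1,\dots,s_d;t_1,\dots,t_d)=\sum_{0<k_1<\dots<k_d}\frac{q^{k_1t_1+\cdots+k_dt_d}}{[k_1]^{s_1}\cdots[k_d]^{s_d}}$$ converges if $\Re(t_j+\dots+t_d)>0$ for all $j=1,\dots,d$. It can be analytically continued to a meromorphic function over $\mathbb{C}^{2d}$ via the series expansion $$f_q(s_1,\dots,s_d;t_1,\dots,t_d)=(1-q)^{s_1+\dots+s_d}\sum_{r_1,\dots,r_d=0}^{+\infty}\prod_{j=1}^d\left[\binom{s_j+r_j-1}{r_j}\frac{q^{j(r_j+t_j)}}{1-q^{r_j+t_j+\cdots+r_d+t_d}}\right].$$ It has the following (simple) poles: $t_j+\dots+t_d\in\mathbb{Z}_{\le 0}+\frac{2\pi i}{\log q}\mathbb{Z}$, $j=1,\dots,d$.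
   Context: For a positive integer $k$, $[k]=(1-q^k)/(1-q)$. The variables $s_1,\dots,s_d,t_1,\dots,t_d$ are complex. For complex $x$ and an integer $r\ge0$, $\binom{x}{r}=x(x-1)\cdots(x-r+1)/r!$. $\mathbb{Z}_{\le0}$ is the set of integers $\le0$. The exponent $r_j+t_j+\cdots+r_d+t_d$ means $\sum_{i=j}^d(r_i+t_i)$. *)

(* Defs.v *)
From HB Require Import structures.
From mathcomp Require Import all_boot all_order all_algebra.
From mathcomp Require Import complex.
From mathcomp Require Import all_classical all_reals all_analysis.
From mathcomp.analysis.showcase Require Import summability(totally, partial_sum, sum).
Set Implicit Arguments.
Unset Strict Implicit.
Unset Printing Implicit Defensive.
Import Order.TTheory GRing.Theory Num.Theory.
Import numFieldNormedType.Exports.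

Local Open Scope classical_set_scope.
Local Open Scope ring_scope.
Local Open Scope complex_scope.

(* R[i] carries the topology and norm of the numFieldType R[i], so that
   [differentiable] below is complex differentiability. *)
HB.instance Definition _ (R : rcfType) := PseudoPointedMetric.copy R[i] R[i]^o.
HB.instance Definition _ (R : rcfType) := NormedModule.copy R[i] R[i]^o.

Section ComplexFunctions.
Variable R : realType.
Implicit Types (x : R) (z : R[i]).

(* x ^ z = exp (z ln x), for 0 < x *)
Definition rpowc x z : R[i] :=
  (expR (complex.Re z * ln x))%:C *
  (cos (complex.Im z * ln x) +i* sin (complex.Im z * ln x)).

Definition cbinom z (r : nat) : R[i] := (\prod_(i < r) (z - i%:R)) / r`!%:R.

Definition qint (q : R) (k : nat) : R := (1 - q ^+ k) / (1 - q).

(* [totally] is the filter of finite subsets of I ordered by inclusion, and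
   [sum a] is the limit of the partial sums of a along it. *)
Definition absolutely_convergent (I : choiceType) (a : I -> R[i]) : Prop :=
  summable [set: I] (fun i => (complex.Re `|a i|)%:E) /\
  cvg (partial_sum a @ totally).

End ComplexFunctions.

Section SeveralComplexVariables.
Variables (R : realType) (V : normedModType R[i]).
Implicit Types (F g h : V -> R[i]) (Z : set V) (p : V).

Definition holomorphic_near g p : Prop := \forall x \near p, differentiable g x.

(* F stands for the function F restricted to the complement of Z: its values
   on Z are irrelevant.  The restriction is holomorphic and is, near every
   point p, a quotient g / h with h a nonzero germ whose zero set contains Z. *)
Definition meromorphic F Z : Prop :=
  [/\ closed Z,
      forall p, ~ Z p -> differentiable F p &
      forall p, exists g h,
        [/\ holomorphic_near g p,
            holomorphic_near h p,
            ~ (\forall x \near p, h x = 0) &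
            \forall x \near p, h x != 0 -> ~ Z x /\ F x = g x / h x]].

(* Points near which F, given off Z, has no holomorphic extension. *)
Definition poles F Z : set V :=
  [set p | ~ exists g, holomorphic_near g p /\
                       \forall x \near p, ~ Z x -> F x = g x].

Section Hyperplanes.
Variables (d : nat) (ell : 'I_d -> V -> R[i]) (L : set R[i]).

Definition hyperplanes : set V := [set p | exists j, L (ell j p)].

(* The order of F along each of the hyperplanes ell j = c, c in L, is exactly
   -1.  For p on several of them, with distinct j, all the corresponding linear
   factors are needed to cancel the poles, each to the first power; the germ g
   so obtained vanishes identically on none of these hyperplanes. *)
Definition simple_poles F : Prop :=
  forall p, exists g,
    [/\ holomorphic_near g p,
        \forall x \near p, ~ hyperplanes x ->
          F x * \prod_(j < d | `[< L (ell j p) >]) (ell j x - ell j p) = g x &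
        forall j, L (ell j p) ->
          ~ (\forall x \near p, ell j x = ell j p -> g x = 0)].

End Hyperplanes.
End SeveralComplexVariables.

Section MultipleQZeta.
Variables (R : realType) (q : R) (d : nat).
Implicit Types (s t : 'rV[R[i]]_d).

(* t_j + ... + t_d *)
Definition tail (j : 'I_d) t : R[i] := \sum_(i < d | (j <= i)%N) t 0 i.

Definition conv_region : set 'rV[R[i]]_d :=
  [set t | forall j, 0 < complex.Re (tail j t)].

(* 0 < k_1 < ... < k_d *)
Definition increasing_index : choiceType := {k : d.-tuple nat | path ltn 0%N k}.

Definition fq_term s t (k : increasing_index) : R[i] :=
  rpowc q (\sum_(j < d) (tnth (val k) j)%:R * t 0 j) /
  \prod_(j < d) rpowc (qint q (tnth (val k) j)) (s 0 j).

Definition fq s t : R[i] := sum (fq_term s t).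

(* Ordinals start at 0, hence the exponent j.+1. *)
Definition expansion_term s t (r : d.-tuple nat) : R[i] :=
  \prod_(j < d)
    (cbinom (s 0 j + (tnth r j)%:R - 1) (tnth r j) *
     (rpowc q (j.+1%:R * ((tnth r j)%:R + t 0 j)) /
      (1 - rpowc q (\sum_(i < d | (j <= i)%N) ((tnth r i)%:R + t 0 i))))).

Definition fq_expansion s t : R[i] :=
  rpowc (1 - q) (\sum_(j < d) s 0 j) * sum (expansion_term s t).

Definition pole_lattice : set R[i] :=
  [set z | exists (n : nat) (m : int),
     z = - n%:R + (2 * pi / ln q)%:C * 'i%C * m%:~R].

Definition polar_locus : set ('rV[R[i]]_d * 'rV[R[i]]_d) :=
  hyperplanes (fun j p => tail j p.2) pole_lattice.

End MultipleQZeta.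

(* Main.v *)
Require Import Defs.
From HB Require Import structures.
From mathcomp Require Import all_boot all_order all_algebra.
From mathcomp Require Import complex finmap.
From mathcomp Require Import all_classical all_reals all_analysis.
From mathcomp.analysis.showcase Require Import summability(totally, partial_sum, sum).
From mathcomp Require Import ring lra.
Set Implicit Arguments.
Unset Strict Implicit.
Unset Printing Implicit Defensive.
Import Order.TTheory GRing.Theory Num.Theory.
Import numFieldNormedType.Exports.
Local Open Scope classical_set_scope.
Local Open Scope ring_scope.
Local Open Scope complex_scope.

(** Expand each factor (1 - q^k)^(-s) by the binomial series and write the indices
   k_1 < ... < k_d through their gaps, so that for a fixed r the sum over k is a
   product of d geometric series. If all the tails t_j + ... + t_d have a positive
   real part, the double family indexed by the gaps and by r is dominated by a
   product of convergent series in one variable, and Fubini gives both the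
   absolute convergence and the equality of the two series ([fq_identity]). The
   complex binomial series itself is identified through its differential equation
   (1 - x) y' = s y ([binomial_seriesE]).

   The expansion converges wherever no denominator 1 - q^(r_j + ... + r_d + tail_j)
   vanishes, because these denominators tend to 1: they are bounded away from 0
   uniformly in r ([qpow_away]), whereas the remaining factors are dominated by a
   summable product. The denominators vanish exactly on the pole lattice, and
   near a point p of the polar locus each hyperplane through p is the zero set of
   the denominators for a single value of r_j + ... + r_d, which vanish to first
   order. Multiplying by the linear factors of these hyperplanes ([polar_factor])
   and filling the removable singularity of w/(1 - q^w) turns the series into one
   that converges normally near p, also on the hyperplanes ([germ],
   [germ_local]). Hence F is locally the quotient of [germ] by [polar_factor].

   Holomorphy of a series is proved without Cauchy's integral formula. A function
   is given, on a ball of fixed radius, a value, a linear part and a quadratic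
   remainder with explicit constants ([jet]); the total of these constants is
   submultiplicative ([jetNM]) and stable under substitution ([jet_comp]), so it
   can be estimated for the general term of the series, and if its sum over all
   terms is finite then the series has an expansion of the same kind
   ([jet_sum]).

   The poles are genuine and simple because the germ does not vanish identically
   on any hyperplane through p ([germ_nonvanishing]). On such a hyperplane, for a
   fixed t on no other one, the germ is up to an exponential factor a normally
   convergent series of polynomials in s. If it vanished for s near a given point it
   would vanish for all s ([gterm_line_eq0]), whereas at s = (0, .., 1, .., 0)
   exactly one term of the series survives. A holomorphic extension of F at p would
   force this vanishing, since [polar_factor] is zero on the hyperplane. *)

(** * Real-valued norms and unordered sums *)

Section Norm.
Variable R : realType.
Local Notation C := R[i].

(** The norm of a normed space over C takes its values in C, whose order is
   partial; its real part can be used in linear arithmetic over R. *)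
Definition nrm (V : normedModType C) (v : V) : R := complex.Re `|v|.

Section Mod.
Variable V : normedModType C.
Implicit Types v w : V.

Lemma nrmE v : (nrm v)%:C = `|v|.
Proof. by apply: RRe_real; apply: normr_real. Qed.

Lemma nrm_ge0 v : 0 <= nrm v.
Proof. by rewrite -ler0c nrmE. Qed.

Lemma nrm0 : nrm (0 : V) = 0.
Proof. by apply: complexI; rewrite nrmE normr0. Qed.

Lemma nrm_eq0 v : nrm v = 0 -> v = 0.
Proof. by move=> v0; apply: normr0_eq0; rewrite -nrmE v0. Qed.

Lemma nrmN v : nrm (- v) = nrm v.
Proof. by rewrite /nrm normrN. Qed.

Lemma nrmD v w : nrm (v + w) <= nrm v + nrm w.
Proof. by rewrite -lecR rmorphD/= !nrmE ler_normD. Qed.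

Lemma nrmB v w : nrm (v - w) <= nrm v + nrm w.
Proof. by rewrite -[nrm w]nrmN nrmD. Qed.

Lemma nrmC v w : nrm (v - w) = nrm (w - v).
Proof. by rewrite -nrmN opprB. Qed.

Lemma nrmD3 u v w : nrm (v - w) <= nrm (v - u) + nrm (u - w).
Proof. by rewrite -[v - w](subrKA u) nrmD. Qed.

Lemma nrm_sum (I : Type) (r : seq I) (P : pred I) (F : I -> V) :
  nrm (\sum_(i <- r | P i) F i) <= \sum_(i <- r | P i) nrm (F i).
Proof.
elim/big_rec2: _ => [|i y x _ h]; first by rewrite nrm0.
by rewrite (le_trans (nrmD _ _))// lerD2l.
Qed.

Lemma nbhs_nrm (x : V) (P : set V) :
  (\forall y \near x, P y) <-> exists2 e : R, 0 < e & forall y, nrm (y - x) < e -> P y.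
Proof.
rewrite -nbhs_nearE; split.
  move=> /nbhs_normP[e /= e0 eP].
  exists (complex.Re e); first by move: e0; rewrite ltcE => /andP[].
  move=> y xy; apply: eP => /=; rewrite -normrN opprB -nrmE.
  by rewrite -(RRe_real (gtr0_real e0)) ltcR.
move=> [e e0 eP]; apply/nbhs_normP; exists e%:C => /=; first by rewrite ltcR.
by move=> y /=; rewrite -normrN opprB -nrmE ltcR; apply: eP.
Qed.

End Mod.

Lemma nrmM (x y : C) : nrm (x * y) = nrm x * nrm y.
Proof. by apply: complexI; rewrite rmorphM/= !nrmE normrM. Qed.

Lemma nrmZ (V : normedModType C) (a : C) (v : V) : nrm (a *: v) = nrm a * nrm v.
Proof. by apply: complexI; rewrite rmorphM/= !nrmE normrZ. Qed.

Lemma nrm1 : nrm (1 : C) = 1.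
Proof. by apply: complexI; rewrite nrmE normr1. Qed.

Lemma nrmV (x : C) : nrm x^-1 = (nrm x)^-1.
Proof. by apply: complexI; rewrite fmorphV/= !nrmE normfV. Qed.

Lemma nrm_real (x : R) : nrm (x%:C) = `|x|.
Proof. by apply: complexI; rewrite nrmE normc_def/= expr0n/= addr0 sqrtr_sqr. Qed.

Lemma nrm_nat n : nrm (n%:R : C) = n%:R.
Proof. by rewrite -[_%:R](rmorph_nat (real_complex R)) nrm_real ger0_norm. Qed.

Lemma nrm_prod (I : Type) (r : seq I) (P : pred I) (F : I -> C) :
  nrm (\prod_(i <- r | P i) F i) = \prod_(i <- r | P i) nrm (F i).
Proof. by elim/big_rec2: _ => [|i y x _ <-]; rewrite ?nrm1 ?nrmM. Qed.

Lemma nrmX (x : C) n : nrm (x ^+ n) = nrm x ^+ n.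
Proof. by elim: n => [|n ih]; rewrite ?expr0 ?nrm1// !exprS nrmM ih. Qed.

Lemma nrm_Re (x : C) : `|complex.Re x| <= nrm x.
Proof. by rewrite -lecR nrmE normc_ge_Re. Qed.

Lemma nrm_Im (x : C) : `|complex.Im x| <= nrm x.
Proof.
have := nrm_Re ('i%C * x); rewrite mulrC ReiNIm normrN nrmM.
suff -> : nrm ('i%C : C) = 1 by rewrite mulr1.
by apply: complexI; rewrite nrmE normc_def/= expr0n expr1n add0r sqrtr1.
Qed.

Lemma nrm_le_ReIm (x : C) : nrm x <= `|complex.Re x| + `|complex.Im x|.
Proof.
rewrite {1}[x]complexE (le_trans (nrmD _ _))// nrm_real lerD2l nrmM nrm_real.
suff -> : nrm ('i%C : C) = 1 by rewrite mul1r.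
by apply: complexI; rewrite nrmE normc_def/= expr0n expr1n add0r sqrtr1.
Qed.

Lemma nrm_gt0 (x : C) : (0 < nrm x) = (x != 0).
Proof. by rewrite -ltcR nrmE normr_gt0. Qed.

Lemma eq_of_nrm_small (V : normedModType C) (x y : V) :
  (forall e, 0 < e -> nrm (x - y) < e) -> x = y.
Proof.
move=> h; apply/eqP; rewrite -subr_eq0; apply/eqP/nrm_eq0/eqP.
rewrite eq_le nrm_ge0 andbT leNgt; apply/negP => /h.
by rewrite ltxx.
Qed.

End Norm.

Section Sums.
Variable R : realType.
Local Notation C := R[i].

(** For a nonnegative family this is summability; the bound M is kept, since
   every estimate below is a comparison between such bounds. *)
Definition bsum (I : choiceType) (m : I -> R) (M : R) :=
  forall A : {fset I}, \sum_(i <- A) m i <= M.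

(** Convergence of the partial sums along the filter of finite subsets, spelled
   out so that finite sets of indices can be enlarged explicitly. *)
Definition hassum (I : choiceType) (a : I -> C) (S : C) :=
  forall e : R, 0 < e -> exists A0 : {fset I}, forall A : {fset I},
    (A0 `<=` A)%fset -> nrm (\sum_(i <- A) a i - S) < e.

Section Basics.
Variable I : choiceType.
Implicit Types (a b : I -> C) (m : I -> R).

Lemma partial_sumE a A : partial_sum a A = \sum_(i <- A) a i.
Proof. by rewrite /partial_sum big_seq_fsetE. Qed.

Lemma hassum_cvg a S : hassum a S -> partial_sum a @ totally --> S.
Proof.
move=> h; have FF := @summability.totally_filter I.
apply/cvgrPdist_lt => e e0; near_simpl.
have e1 : e = (complex.Re e)%:C by apply/esym/RRe_real/gtr0_real.
have [|A0 hA] := h (complex.Re e); first by rewrite -ltcR -e1.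
exists A0 => // A /hA; rewrite -ltcR -e1 nrmE distrC.
by rewrite -partial_sumE.
Qed.

Lemma hassum_sum a S : hassum a S -> sum a = S.
Proof.
move=> /hassum_cvg h; have FF := @summability.totally_filter I.
exact: cvg_lim.
Qed.

Lemma hassum_unique a S T : hassum a S -> hassum a T -> S = T.
Proof. by move=> /hassum_sum <- /hassum_sum. Qed.

Lemma eq_hassum a b S : a =1 b -> hassum a S -> hassum b S.
Proof. by move=> /funext ->. Qed.

Lemma hassumD a b S T : hassum a S -> hassum b T -> hassum (fun i => a i + b i) (S + T).
Proof.
move=> ha hb e e0; have e2 : 0 < e / 2 by rewrite divr_gt0.
have [A hA] := ha _ e2; have [B hB] := hb _ e2.
exists (A `|` B)%fset => D; rewrite fsubUset => /andP[/hA h1 /hB h2].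
rewrite big_split/= opprD addrACA (le_lt_trans (nrmD _ _))//.
by rewrite [ltRHS]splitr ltrD.
Qed.

Lemma hassumZ (c : C) a S : hassum a S -> hassum (fun i => c * a i) (c * S).
Proof.
move=> ha e e0; have [A hA] : exists A0 : {fset I}, forall A : {fset I},
    (A0 `<=` A)%fset -> nrm (\sum_(i <- A) a i - S) < e / (nrm c + 1).
  by apply: ha; rewrite divr_gt0// ltr_wpDl// nrm_ge0.
exists A => D /hA; rewrite -mulr_sumr -mulrBr nrmM.
rewrite ltr_pdivlMr; last by rewrite ltr_wpDl// nrm_ge0.
apply: le_lt_trans; rewrite mulrC ler_wpM2l ?nrm_ge0//.
by rewrite lerDl.
Qed.

Lemma hassumB a b S T : hassum a S -> hassum b T -> hassum (fun i => a i - b i) (S - T).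
Proof.
move=> ha /(hassumZ (-1)) hb; rewrite -mulN1r; apply: eq_hassum (hassumD ha hb).
by move=> i /=; rewrite mulN1r.
Qed.

Lemma hassum_fset a (A : {fset I}) :
  (forall i, i \notin A -> a i = 0) -> hassum a (\sum_(i <- A) a i).
Proof.
move=> h e e0; exists A => B AB.
rewrite -(big_fset_incl _ AB) ?subrr ?nrm0//.
by move=> i _ /h.
Qed.

Lemma hassum1 a i0 : (forall i, i != i0 -> a i = 0) -> hassum a (a i0).
Proof.
move=> h; have := @hassum_fset a [fset i0]%fset; rewrite big_seq_fset1; apply.
by move=> i; rewrite inE; apply: h.
Qed.

Lemma bsum_ge0 m M : bsum m M -> 0 <= M.
Proof. by move=> /(_ fset0); rewrite big_seq_fset0. Qed.

Lemma le_bsum m1 m2 M : (forall i, m1 i <= m2 i) -> bsum m2 M -> bsum m1 M.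
Proof. by move=> h b A; apply: le_trans (b A); apply: ler_sum. Qed.

Lemma bsumD m1 m2 M1 M2 : bsum m1 M1 -> bsum m2 M2 ->
  bsum (fun i => m1 i + m2 i) (M1 + M2).
Proof. by move=> h1 h2 A; rewrite big_split/= lerD. Qed.

Lemma bsumZ m M c : 0 <= c -> bsum m M -> bsum (fun i => c * m i) (c * M).
Proof. by move=> c0 h A; rewrite -mulr_sumr ler_wpM2l. Qed.

Lemma hassum_nrm_le a S M : bsum (fun i => nrm (a i)) M -> hassum a S -> nrm S <= M.
Proof.
move=> bM h; apply/ler_addgt0Pr => e /h[A /(_ A (fsubset_refl _)) hA].
rewrite -[S](subKr (\sum_(i <- A) a i)) (le_trans (nrmB _ _))// lerD ?(ltW hA)//.
by rewrite (le_trans (nrm_sum _ _ _)).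
Qed.

Lemma sum_fset_le m (A B : {fset I}) : (forall i, 0 <= m i) -> (A `<=` B)%fset ->
  \sum_(i <- A) m i <= \sum_(i <- B) m i.
Proof.
move=> m0 AB; rewrite [leRHS](big_fsetID _ (mem A))/=.
have -> : [fset x | x in B & x \in A]%fset = A.
  apply/fsetP => x; rewrite !inE/=; apply/andP/idP => [[]//|xA]; split=> //.
  exact: (fsubsetP AB).
by rewrite lerDl; apply: sumr_ge0.
Qed.

Lemma hassum_ge0 m M : (forall i, 0 <= m i) -> bsum m M ->
  exists S, hassum (fun i => (m i)%:C) S%:C.
Proof.
move=> m0 bM; pose E := [set \sum_(i <- A) m i | A in [set: {fset I}]].
have supE : has_sup E.
  split; first by exists (\sum_(i <- fset0) m i), fset0.
  by exists M => _ [A _ <-].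
exists (sup E) => e e0; have [_ [A _ <-] hA] := sup_adherent e0 supE.
exists A => B AB; rewrite -rmorph_sum -rmorphB/= nrm_real distrC ger0_norm.
  by rewrite ltrBlDr -ltrBlDl (lt_le_trans hA)// sum_fset_le.
by rewrite subr_ge0; apply: ub_le_sup; [exact: supE.2|exists B].
Qed.

Lemma bsum_lub m M : (forall i, 0 <= m i) -> bsum m M ->
  exists S, bsum m S /\ hassum (fun i => (m i)%:C) S%:C.
Proof.
move=> m0 bM; have [S hS] := hassum_ge0 m0 bM; exists S; split=> // A.
apply/ler_addgt0Pr => e e0; have [B hB] := hS _ e0.
have := hB (A `|` B)%fset (fsubsetUr _ _).
rewrite -rmorph_sum -rmorphB/= nrm_real ltr_norml => /andP[_].
rewrite ltrBlDr => /ltW h; rewrite addrC; apply: le_trans h.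
by rewrite sum_fset_le// fsubsetUl.
Qed.

(** With n = |a|, the families n + Re a and n + Im a are nonnegative and bounded,
   so that the sum of a is obtained from suprema of real numbers. *)
Lemma bsum_hassum a M : bsum (fun i => nrm (a i)) M -> exists S, hassum a S.
Proof.
move=> bM; pose n i := nrm (a i).
have [N hN] : exists S, hassum (fun i => (n i)%:C) S%:C.
  by apply: hassum_ge0 bM => i; apply: nrm_ge0.
have b2 : bsum (fun i => n i + n i) (M + M) by apply: bsumD.
have aux (f : I -> R) : (forall i, `|f i| <= n i) ->
    exists S, hassum (fun i => (f i)%:C) S.
  move=> fn; have [] := @hassum_ge0 (fun i => n i + f i) (M + M).
  - by move=> i; move: (fn i); rewrite ler_norml => /andP[]; lra.
  - by apply: le_bsum b2 => i; move: (fn i); rewrite ler_norml => /andP[]; lra.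
  - move=> S hS; exists (S%:C - N%:C); apply: eq_hassum (hassumB hS hN).
    by move=> i /=; rewrite -rmorphB/= addrC addKr.
have [S1 h1] := aux (fun i => complex.Re (a i)) (fun i => nrm_Re _).
have [S2 h2] := aux (fun i => complex.Im (a i)) (fun i => nrm_Im _).
exists (S1 + 'i%C * S2); apply: eq_hassum (hassumD h1 (hassumZ 'i%C h2)).
by move=> i /=; rewrite -complexE.
Qed.

Lemma bsum_hassum_sum a M : bsum (fun i => nrm (a i)) M -> hassum a (sum a).
Proof. by move=> /bsum_hassum[S h]; rewrite (hassum_sum h). Qed.

Lemma absolutely_convergent_bsum a M : bsum (fun i => nrm (a i)) M ->
  absolutely_convergent a.
Proof.
move=> bM; split; last first.
  have [S /hassum_cvg h] := bsum_hassum bM; apply/cvg_ex; by exists S.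
rewrite /summable; apply: (@le_lt_trans _ _ M%:E); last by rewrite ltry.
apply: ge_ereal_sup => _ [A [finA _] <-].
rewrite fsbig_finite//=; under eq_bigr do rewrite ger0_norm ?(nrm_ge0 (_ : C))//.
rewrite sumEFin lee_fin; exact: bM.
Qed.

End Basics.
End Sums.

 
(** * Fubini, products and power series *)

Section Families.
Variable R : realType.
Local Notation C := R[i].

Lemma bsum_inj (I J : choiceType) (h : J -> I) (m : I -> R) M :
  injective h -> bsum m M -> bsum (fun j => m (h j)) M.
Proof.
move=> hi bM A; have := bM [fset h j | j in A]%fset.
by rewrite big_imfset//= => x y _ _ /hi.
Qed.

Lemma hassum_bij (I J : choiceType) (h : J -> I) (g : I -> J) (a : I -> C) S :
  cancel h g -> cancel g h -> hassum a S -> hassum (fun j => a (h j)) S.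
Proof.
move=> hg gh ha e /ha[A0 hA]; exists [fset g i | i in A0]%fset => A sA.
have := hA [fset h j | j in A]%fset; rewrite big_imfset/=; last first.
  by move=> x y _ _ /(can_inj hg).
apply; apply/fsubsetP => i iA; rewrite -(gh i); apply: in_imfset.
by apply: (fsubsetP sA); apply: in_imfset.
Qed.

Definition fsetprod (I J : choiceType) (A : {fset I}) (B : {fset J}) : {fset I * J} :=
  [fset ((i, j) : (I * J)%type) | i : I in A, j : J in B]%fset.

Lemma in_fsetprod (I J : choiceType) (A : {fset I}) (B : {fset J}) i j :
  i \in A -> j \in B -> (i, j) \in fsetprod A B.
Proof. by move=> iA jB; apply/imfset2P; exists i => //; exists j. Qed.

Lemma sum_fsetprod (V : zmodType) (I J : choiceType) (m : I * J -> V)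
    (A : {fset I}) (B : {fset J}) :
  \sum_(p <- fsetprod A B) m p = \sum_(i <- A) \sum_(j <- B) m (i, j).
Proof.
rewrite /fsetprod; rewrite (big_imfset2 +%R)//=.
by move=> [i j] [i' j'] /= _ _ [-> ->].
Qed.

Section Fubini.
Variables (I J : choiceType).

Lemma sum_approx (f : I * J -> C) (g : I -> C) (s : seq I) (e : R) : 0 < e ->
  (forall i, hassum (fun j => f (i, j)) (g i)) ->
  exists B0 : {fset J}, forall B : {fset J}, (B0 `<=` B)%fset ->
    \sum_(i <- s) nrm (\sum_(j <- B) f (i, j) - g i) < e.
Proof.
move=> e0 fg; elim: s e e0 => [|i s ih] e e0.
  by exists fset0 => B _; rewrite big_nil.
have e2 : 0 < e / 2 by rewrite divr_gt0.
have [B1 h1] := ih _ e2; have [B2 h2] := fg i _ e2.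
exists (B1 `|` B2)%fset => B; rewrite fsubUset => /andP[/h1 l1 /h2 l2].
by rewrite big_cons [ltRHS]splitr ltrD.
Qed.

(** For a finite set A of first indices, the inner sums are replaced, with a
   total error e, by sums over one common finite set of second indices; the
   total sum is then compared with the sum over a rectangle. *)
Lemma hassum_fubini (f : I * J -> C) (g : I -> C) M S :
  bsum (fun p => nrm (f p)) M -> hassum f S ->
  (forall i, hassum (fun j => f (i, j)) (g i)) ->
  bsum (fun i => nrm (g i)) M /\ hassum g S.
Proof.
move=> bM hf fg; split=> [A|e e0].
  apply/ler_addgt0Pr => e e0; have [B hB] := sum_approx A e0 fg.
  have {}hB := hB _ (fsubset_refl _).
  have hM := bM (fsetprod A B); rewrite sum_fsetprod in hM.
  apply: le_trans (lerD hM (ltW hB)); rewrite -big_split/=.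
  apply: ler_sum => i _; rewrite -{1}[g i](subKr (\sum_(j <- B) f (i, j))).
  by rewrite (le_trans (nrmB _ _))// lerD//; apply: nrm_sum.
have e2 : 0 < e / 2 by rewrite divr_gt0.
have [D hD] := hf _ e2; exists [fset p.1 | p in D]%fset => A sA.
have [B hB] := sum_approx A e2 fg.
have {hB} := hB (B `|` [fset p.2 | p in D])%fset (fsubsetUl _ _).
set B' := (B `|` _)%fset => hB.
have DAB : (D `<=` fsetprod A B')%fset.
  apply/fsubsetP => -[i j] pD; apply: in_fsetprod.
    by apply: (fsubsetP sA); apply/imfsetP; exists (i, j).
  by rewrite inE; apply/orP; right; apply/imfsetP; exists (i, j).
have := hD _ DAB; rewrite sum_fsetprod => h.
rewrite (le_lt_trans (nrmD3 (\sum_(i <- A) \sum_(j <- B') f (i, j)) _ _))//.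
rewrite [ltRHS]splitr ltrD//; apply: le_lt_trans hB.
rewrite -sumrB (le_trans (nrm_sum _ _ _))//.
by apply: ler_sum => i _; rewrite nrmC.
Qed.

Lemma bsum_pair (f : I * J -> R) (m : I -> R) M : (forall p, 0 <= f p) ->
  (forall i, bsum (fun j => f (i, j)) (m i)) -> bsum m M -> bsum f M.
Proof.
move=> f0 fm mM D.
pose E := fsetprod [fset p.1 | p in D]%fset [fset p.2 | p in D]%fset.
have DE : (D `<=` E)%fset.
  apply/fsubsetP => -[i j] pD; apply: in_fsetprod; apply/imfsetP.
    by exists (i, j).
  by exists (i, j).
apply: (le_trans (sum_fset_le f0 DE)); rewrite sum_fsetprod.
by apply: (le_trans _ (mM [fset p.1 | p in D]%fset)); apply: ler_sum => i _; exact: fm.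
Qed.

Lemma bsum_prod (m : I -> R) (n : J -> R) M N :
  (forall i, 0 <= m i) -> (forall j, 0 <= n j) -> bsum m M -> bsum n N ->
  bsum (fun p : I * J => m p.1 * n p.2) (M * N).
Proof.
move=> m0 n0 mM nN; apply: (bsum_pair (m := fun i => m i * N)) => [p|i|].
- by rewrite mulr_ge0.
- exact: (bsumZ (m0 i) nN).
- by move=> A; rewrite -mulr_suml ler_wpM2r// (bsum_ge0 nN).
Qed.

Lemma hassum_prod (a : I -> C) (b : J -> C) M N S T :
  bsum (fun i => nrm (a i)) M -> bsum (fun j => nrm (b j)) N ->
  hassum a S -> hassum b T -> hassum (fun p : I * J => a p.1 * b p.2) (S * T).
Proof.
move=> aM bN aS bT.
have ab : bsum (fun p : I * J => nrm (a p.1 * b p.2)) (M * N).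
  apply: le_bsum (bsum_prod (fun i => nrm_ge0 (a i)) (fun j => nrm_ge0 (b j)) aM bN).
  by move=> p; rewrite nrmM.
have [U hU] := bsum_hassum ab.
have [_ h] := hassum_fubini (g := fun i => a i * T) ab hU (fun i => hassumZ (a i) bT).
suff -> : S * T = U by [].
apply: hassum_unique h; rewrite mulrC; apply: eq_hassum (hassumZ T aS) => i.
exact: mulrC.
Qed.

End Fubini.

(** Both iterated sums are computed from the same unordered double sum. *)
Lemma hassum_fubini_swap (I J : choiceType) (f : I * J -> C) g h M :
  bsum (fun p => nrm (f p)) M ->
  (forall i, hassum (fun j => f (i, j)) (g i)) ->
  (forall j, hassum (fun i => f (i, j)) (h j)) ->
  bsum (fun i => nrm (g i)) M /\ exists2 S, hassum g S & hassum h S.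
Proof.
move=> fM fg fh; have [U hU] := bsum_hassum fM.
have [gM gU] := hassum_fubini fM hU fg; split=> //; exists U => //.
pose sw (K L : choiceType) (p : K * L) := (p.2, p.1).
have swK (K L : choiceType) : cancel (@sw K L) (@sw L K) by case.
have hU' := hassum_bij (swK J I) (swK I J) hU.
have fM' : bsum (fun p => nrm (f (@sw J I p))) M.
  by apply: (bsum_inj (can_inj (swK J I)) fM).
by have [_] := hassum_fubini (g := h) fM' hU' fh.
Qed.

Section Tuples.

Lemma tuple_cons_can d :
  cancel (fun r : d.+1.-tuple nat => (thead r, behead_tuple r))
         (fun p => [tuple of p.1 :: p.2]).
Proof. by move=> r; rewrite /= -tuple_eta. Qed.

Lemma bsum_tuple d (m : 'I_d -> nat -> R) (M : 'I_d -> R) :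
  (forall j n, 0 <= m j n) -> (forall j, bsum (m j) (M j)) ->
  bsum (fun r : d.-tuple nat => \prod_(j < d) m j (tnth r j)) (\prod_(j < d) M j).
Proof.
elim: d m M => [|d ih] m M m0 mM.
  move=> A; rewrite big_ord0; under eq_bigr do rewrite big_ord0.
  have sA : (A `<=` [fset [tuple]])%fset.
    by apply/fsubsetP => x _; rewrite tuple0 inE.
  by apply: le_trans (sum_fset_le _ sA) _ => //; rewrite big_seq_fset1.
rewrite big_ord_recl.
have b0 (r : d.-tuple nat) : 0 <= \prod_(j < d) m (lift ord0 j) (tnth r j).
  by apply: prodr_ge0.
have := bsum_prod (m0 ord0) b0 (mM ord0) (ih _ _ (fun j => m0 (lift ord0 j))
   (fun j => mM (lift ord0 j))).
move=> /(bsum_inj (can_inj (@tuple_cons_can d))); apply: le_bsum => r /=.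
rewrite big_ord_recl le_eqVlt; apply/orP; left; apply/eqP.
by congr (_ * _); apply: eq_bigr => j _; rewrite tnth_behead; congr (m _ (tnth _ _));
  apply/val_inj; rewrite /= inordK// ltnS.
Qed.

(** Induction on the length: a tuple is a pair of its head and its tail. *)
Lemma hassum_tuple d (a : 'I_d -> nat -> C) (M : 'I_d -> R) (S : 'I_d -> C) :
  (forall j, bsum (fun n => nrm (a j n)) (M j)) -> (forall j, hassum (a j) (S j)) ->
  hassum (fun r : d.-tuple nat => \prod_(j < d) a j (tnth r j)) (\prod_(j < d) S j).
Proof.
elim: d a M S => [|d ih] a M S aM aS.
  rewrite big_ord0; have := @hassum1 _ _ (fun r : 0.-tuple nat =>
    \prod_(j < 0) a j (tnth r j)) [tuple]; rewrite big_ord0; apply.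
  by move=> i; rewrite (tuple0 i) eqxx.
rewrite big_ord_recl.
have b : bsum (fun r : d.-tuple nat =>
    nrm (\prod_(j < d) a (lift ord0 j) (tnth r j))) (\prod_(j < d) M (lift ord0 j)).
  have := bsum_tuple (fun j n => nrm_ge0 (a (lift ord0 j) n)) (fun j => aM (lift ord0 j)).
  by apply: le_bsum => r; rewrite nrm_prod.
have := hassum_prod (aM ord0) b (aS ord0)
  (ih (fun j => a (lift ord0 j)) _ _ (fun j => aM (lift ord0 j)) (fun j => aS (lift ord0 j))).
have gh : cancel (fun p : nat * d.-tuple nat => [tuple of p.1 :: p.2])
    (fun r : d.+1.-tuple nat => (thead r, behead_tuple r)).
  by move=> [n r] /=; rewrite theadE; congr pair; apply/val_inj.
move=> /(hassum_bij (@tuple_cons_can d) gh); apply: eq_hassum => r /=.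
rewrite big_ord_recl; congr (_ * _); apply: eq_bigr => j _; rewrite tnth_behead.
by congr (a _ (tnth _ _)); apply/val_inj; rewrite /= inordK// ltnS.
Qed.

End Tuples.

Section NatSeries.
Implicit Types a : nat -> C.

Lemma fset_nat_bound (A : {fset nat}) : exists N, forall n, (N <= n)%N ->
  (A `<=` [fset i in iota 0 n])%fset.
Proof.
exists (\max_(i <- A) i).+1 => n hn; apply/fsubsetP => i iA.
rewrite !inE/= mem_iota/= add0n (leq_trans _ hn)// ltnS.
by apply: leq_bigmax_seq.
Qed.

Lemma sum_fset_iota (V : zmodType) (a : nat -> V) n :
  \sum_(i <- [fset i in iota 0 n]%fset) a i = \sum_(i < n) a i.
Proof.
rewrite -(big_mkord xpredT) /index_iota subn0.
apply: perm_big; apply: uniq_perm; [exact: fset_uniq|exact: iota_uniq|].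
by move=> i; rewrite !inE.
Qed.

Lemma hassum_nat_cvg a S (e : R) : hassum a S -> 0 < e ->
  exists N, forall n, (N <= n)%N -> nrm (\sum_(i < n) a i - S) < e.
Proof.
move=> h /h[A hA]; have [N hN] := fset_nat_bound A.
by exists N => n /hN /hA; rewrite sum_fset_iota.
Qed.

Lemma hassum_nat a S M : bsum (fun n => nrm (a n)) M ->
  (forall e : R, 0 < e -> exists N, forall n, (N <= n)%N ->
     nrm (\sum_(i < n) a i - S) < e) -> hassum a S.
Proof.
move=> aM h; have [T hT] := bsum_hassum aM; suff -> : S = T by [].
apply: eq_of_nrm_small => e e0; have e2 : 0 < e / 2 by rewrite divr_gt0.
have [N1 h1] := h _ e2; have [N2 h2] := hassum_nat_cvg hT e2.
rewrite (le_lt_trans (nrmD3 (\sum_(i < maxn N1 N2) a i) _ _))//.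
rewrite [ltRHS]splitr ltrD//; first by rewrite nrmC h1// leq_maxl.
by rewrite h2// leq_maxr.
Qed.

Lemma bsum_nat (m : nat -> R) M : (forall n, 0 <= m n) ->
  (forall n, \sum_(i < n) m i <= M) -> bsum m M.
Proof.
move=> m0 h A; have [N hN] := fset_nat_bound A.
by apply: le_trans (h N); rewrite -sum_fset_iota sum_fset_le// hN.
Qed.

Lemma hassum_shift a S : hassum a S -> hassum (fun n => a n.+1) (S - a 0).
Proof.
move=> h e /h[A hA]; have [N hN] := fset_nat_bound A.
exists [fset i in iota 0 N]%fset => B sB.
have z : 0%N \notin [fset n.+1 | n in B]%fset by apply/imfsetP => -[].
have := hA (0%N |` [fset n.+1 | n in B])%fset.
rewrite big_fsetU1//= big_imfset/=; last by move=> x y _ _ [].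
have -> : a 0%N + \sum_(i <- B) a i.+1 - S = \sum_(i <- B) a i.+1 - (S - a 0%N) by ring.
apply.
apply/fsubsetP => -[|i] /(fsubsetP (hN _ (leqnSn _))) iN; first exact: fset1U1.
apply/fset1UP; right; apply: in_imfset; apply: (fsubsetP sB).
by move: iN; rewrite !inE/= !mem_iota/=.
Qed.

Lemma bsum_geometric (y : R) : 0 <= y < 1 -> bsum (fun n => y ^+ n) (1 - y)^-1.
Proof.
move=> /andP[y0 y1]; apply: bsum_nat => [n|n]; first exact: exprn_ge0.
have y1' : 0 < 1 - y by rewrite subr_gt0.
rewrite -[leRHS]mul1r ler_pdivlMr// mulrC -opprB mulNr -subrX1 opprB.
by rewrite gerBl exprn_ge0.
Qed.

Lemma expr_lt_eventually (y e : R) : 0 <= y < 1 -> 0 < e ->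
  exists N, forall n, (N <= n)%N -> y ^+ n < e.
Proof.
move=> /andP[y0 y1] e0.
have /cvgrPdist_lt/(_ _ e0)[N _ hN] : (fun n => y ^+ n) @ \oo --> (0 : R).
  by apply: cvg_expr; rewrite ger0_norm.
exists N => n /hN /=; rewrite sub0r normrN ger0_norm// exprn_ge0//.
Qed.

Lemma hassum_geometric (x : C) : nrm x < 1 -> hassum (fun n => x ^+ n) (1 - x)^-1.
Proof.
move=> x1; have x01 : 0 <= nrm x < 1 by rewrite nrm_ge0.
have x1' : 1 - x != 0.
  by rewrite subr_eq0; apply/eqP => e; rewrite -e nrm1 ltxx in x1.
apply: (hassum_nat (M := (1 - nrm x)^-1)) => [|e e0].
  by apply: le_bsum (bsum_geometric x01) => n; rewrite nrmX.
have n1 : 0 < nrm (1 - x) by rewrite nrm_gt0.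
have [N hN] := expr_lt_eventually x01 (mulr_gt0 e0 n1).
exists N => n /hN h.
have -> : \sum_(i < n) x ^+ i - (1 - x)^-1 = - (x ^+ n / (1 - x)).
  apply: (mulIf x1'); rewrite mulrBl mulNr mulVf// mulfVK//.
  by rewrite mulrC -[1 - x]opprB mulNr -subrX1; ring.
by rewrite nrmN nrmM nrmV ltr_pdivrMr ?nrm_gt0// nrmX.
Qed.

End NatSeries.
End Families.

(** * Second-order expansions with explicit constants *)

Section Jets.
Variable R : realType.
Local Notation C := R[i].

(** Differentiability with a quadratic remainder on a ball of fixed radius. The
   number w bounds the variation of f on this ball. Fixing the radius is what
   allows an infinite sum of such functions to be differentiated termwise,
   without Cauchy's integral formula. *)
Definition jet (V : normedModType C) (rho : R) (x : V) (f L : V -> C) (w : R) :=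
  [/\ 0 < rho, forall a u v, L (a *: u + v) = a * L u + L v &
   exists b c, [/\ 0 <= b, 0 <= c, b * rho + c * rho ^+ 2 <= w,
     forall h, nrm (L h) <= b * nrm h &
     forall h, nrm h <= rho -> nrm (f (x + h) - f x - L h) <= c * nrm h ^+ 2]].

(** The quantity |f x| + w behaves like the norm of a Banach algebra: it is
   submultiplicative without any constant, so that products of arbitrarily many
   factors, such as rising factorials, can be estimated factor by factor. *)
Definition jetN (V : normedModType C) (rho : R) (x : V) (f : V -> C) (M : R) :=
  exists L w, jet rho x f L w /\ nrm (f x) + w <= M.

Section OneSpace.
Variable V : normedModType C.
Implicit Types (x h : V) (f g L : V -> C) (rho w M : R).

Lemma jet_ge0 rho x f L w : jet rho x f L w -> 0 <= w.
Proof.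
move=> [r0 _ [b [c [b0 c0 bc _ _]]]]; apply: le_trans bc.
by rewrite addr_ge0// mulr_ge0// ?exprn_ge0// ltW.
Qed.

Lemma jet_le rho x f L w w' : w <= w' -> jet rho x f L w -> jet rho x f L w'.
Proof.
move=> ww [r0 lin [b [c [b0 c0 bc Lb fc]]]]; split=> //; exists b, c; split=> //.
exact: le_trans ww.
Qed.

Lemma jet_cst rho x (k : C) : 0 < rho -> jet rho x (fun=> k) (fun=> 0) 0.
Proof.
move=> r0; split=> // [a u v|]; first by rewrite mulr0 addr0.
exists 0, 0; split=> // [|h|h _]; first by rewrite !mul0r addr0.
  by rewrite nrm0 mul0r.
by rewrite !subrr nrm0 mul0r.
Qed.

Lemma jet_affine rho x f L b : 0 < rho -> 0 <= b ->
  (forall a u v, L (a *: u + v) = a * L u + L v) ->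
  (forall h, nrm (L h) <= b * nrm h) ->
  (forall h, f (x + h) = f x + L h) -> jet rho x f L (b * rho).
Proof.
move=> r0 b0 lin Lb fL; split=> //; exists b, 0; split=> //.
  by rewrite mul0r addr0.
by move=> h _; rewrite fL mul0r [f x + _]addrC addrK subrr nrm0.
Qed.

Lemma jet_variation rho x f L w h : jet rho x f L w -> nrm h <= rho ->
  nrm (f (x + h) - f x) <= w.
Proof.
move=> [r0 _ [b [c [b0 c0 bc Lb fc]]]] hr; rewrite (le_trans _ bc)//.
rewrite -[f (x + h) - f x](subrK (L h)) (le_trans (nrmD _ _))// addrC.
have h0 := nrm_ge0 h.
apply: lerD; first by rewrite (le_trans (Lb h))// ler_wpM2l.
by rewrite (le_trans (fc h hr))// ler_wpM2l// lerXn2r// nnegrE// ltW.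
Qed.

Lemma jet_lin_bound rho x f L w h : jet rho x f L w -> nrm h <= rho -> nrm (L h) <= w.
Proof.
move=> [r0 _ [b [c [b0 c0 bc Lb _]]]] hr; apply: le_trans (Lb h) (le_trans _ bc).
by rewrite (le_trans (ler_wpM2l b0 hr))// lerDl mulr_ge0// exprn_ge0// ltW.
Qed.

Lemma jet_eq rho x f g L w :
  (forall h, nrm h <= rho -> f (x + h) = g (x + h)) ->
  jet rho x f L w -> jet rho x g L w.
Proof.
move=> fg [r0 lin [b [c [b0 c0 bc Lb fc]]]]; split=> //; exists b, c; split=> // h hr.
rewrite -fg//; have := fg 0; rewrite addr0 => <-; first exact: fc.
by rewrite nrm0 ltW.
Qed.

Lemma jetD rho x f g Lf Lg wf wg : jet rho x f Lf wf -> jet rho x g Lg wg ->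
  jet rho x (fun y => f y + g y) (fun h => Lf h + Lg h) (wf + wg).
Proof.
move=> [r0 lf [b [c [b0 c0 bc Lb fc]]]] [_ lg [b' [c' [b0' c0' bc' Lb' fc']]]].
split=> // [a u v|]; first by rewrite lf lg; ring.
exists (b + b'), (c + c'); split; rewrite ?addr_ge0//; first by lra.
  by move=> h; rewrite mulrDl (le_trans (nrmD _ _))// lerD.
move=> h hr; rewrite mulrDl; apply: le_trans (lerD (fc h hr) (fc' h hr)).
by rewrite (le_trans _ (nrmD _ _))// le_eqVlt; apply/orP; left; apply/eqP; congr nrm; ring.
Qed.

Lemma jetM rho x f g Lf Lg wf wg : jet rho x f Lf wf -> jet rho x g Lg wg ->
  jet rho x (fun y => f y * g y) (fun h => f x * Lg h + g x * Lf h)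
    (nrm (f x) * wg + nrm (g x) * wf + wf * wg).
Proof.
move=> [r0 lf [b [c [b0 c0 bc Lb fc]]]] [_ lg [b' [c' [b0' c0' bc' Lb' fc']]]].
split=> // [a u v|]; first by rewrite lf lg; ring.
have F0 := nrm_ge0 (f x); have G0 := nrm_ge0 (g x); have r0' := ltW r0.
set F := nrm (f x) in F0 *; set G := nrm (g x) in G0 *.
exists (F * b' + G * b), (F * c' + G * c + (b + c * rho) * (b' + c' * rho)).
split.
- by rewrite addr_ge0// mulr_ge0.
- by rewrite !(addr_ge0, mulr_ge0).
- have -> : (F * b' + G * b) * rho + (F * c' + G * c + (b + c * rho) * (b' + c' * rho)) * rho ^+ 2
    = F * (b' * rho + c' * rho ^+ 2) + G * (b * rho + c * rho ^+ 2)
      + (b * rho + c * rho ^+ 2) * (b' * rho + c' * rho ^+ 2) by ring.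
  apply: lerD; first by apply: lerD; apply: ler_wpM2l.
  by apply: ler_pM => //; rewrite addr_ge0// mulr_ge0// exprn_ge0.
- move=> h; rewrite (le_trans (nrmD _ _))// !nrmM mulrDl -!mulrA.
  by apply: lerD; apply: ler_wpM2l.
move=> h hr; have t0 := nrm_ge0 h.
pose Rf := f (x + h) - f x - Lf h; pose Rg := g (x + h) - g x - Lg h.
have -> : f (x + h) * g (x + h) - f x * g x - (f x * Lg h + g x * Lf h)
  = f x * Rg + g x * Rf + (Lf h + Rf) * (Lg h + Rg) by rewrite /Rf /Rg; ring.
rewrite [leRHS]mulrDl (le_trans (nrmD _ _))//; apply: lerD.
  rewrite (le_trans (nrmD _ _))// !nrmM mulrDl -!mulrA.
  by apply: lerD; apply: ler_wpM2l => //; [apply: fc'|apply: fc].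
have aux (l r : C) (p k : R) : 0 <= p -> 0 <= k -> nrm l <= p * nrm h -> nrm r <= k * nrm h ^+ 2 ->
    nrm (l + r) <= (p + k * rho) * nrm h.
  move=> p0 k0 hl hrr; rewrite (le_trans (nrmD _ _))// mulrDl lerD// (le_trans hrr)//.
  by rewrite -mulrA ler_wpM2l// expr2 ler_wpM2r.
rewrite nrmM.
have -> : (b + c * rho) * (b' + c' * rho) * nrm h ^+ 2 =
  ((b + c * rho) * nrm h) * ((b' + c' * rho) * nrm h) by ring.
by apply: ler_pM; rewrite ?nrm_ge0//; apply: aux => //; [apply: fc|apply: fc'].
Qed.

Lemma jet_shrink rho rho' x f L w : 0 < rho' <= rho ->
  jet rho x f L w -> jet rho' x f L (w * (rho' / rho)).
Proof.
move=> /andP[r0' rr] [r0 lin [b [c [b0 c0 bc Lb fc]]]]; split=> //.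
exists b, c; split=> //; last by move=> h hr; apply: fc; apply: le_trans rr.
apply: (@le_trans _ _ ((b * rho + c * rho ^+ 2) * (rho' / rho))).
  have -> : (b * rho + c * rho ^+ 2) * (rho' / rho) = b * rho' + c * (rho * rho').
    by field; rewrite gt_eqF.
  by rewrite lerD2l ler_wpM2l// expr2 ler_wpM2r// ltW.
by rewrite ler_wpM2r// divr_ge0// ltW.
Qed.

Lemma jet_shrinkW rho rho' x f L w : 0 < rho' <= rho ->
  jet rho x f L w -> jet rho' x f L w.
Proof.
move=> rr j; apply: jet_le (jet_shrink rr j); case/andP: rr => r0' rr.
rewrite ler_piMr ?(jet_ge0 j)// ler_pdivrMr ?mul1r//.
exact: lt_le_trans rr.
Qed.

Lemma jet_small rho x f L w e : 0 < e -> jet rho x f L w ->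
  exists2 r, 0 < r <= rho & forall rho', 0 < rho' <= r -> jet rho' x f L e.
Proof.
move=> e0 j; have w0 := jet_ge0 j; have [r0 _ _] := j.
have w1 : 0 < w + 1 by rewrite ltr_wpDl.
pose r := Num.min rho (rho * (e / (w + 1))).
have rp : 0 < r by rewrite lt_min r0/= mulr_gt0// divr_gt0.
have rle : r <= rho by rewrite ge_min lexx.
exists r; rewrite ?rp// => rho' /andP[r'0 r'r].
have : rho' <= rho * (e / (w + 1)) by rewrite (le_trans r'r)// ge_min lexx orbT.
move=> h; have r'rho := le_trans r'r rle.
have := @jet_shrink rho rho' x f L w; rewrite r'0 r'rho => /(_ isT j); apply: jet_le.
apply: (@le_trans _ _ ((w + 1) * (rho' / rho))).
  by rewrite ler_wpM2r ?lerDl// divr_ge0// ltW.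
by rewrite mulrC -ler_pdivlMr// ler_pdivrMr// mulrC.
Qed.

(** If g varies by at most W = b rho + c rho^2 and f has the constants b', c',
   then f o g has a variation bounded by b' W + c' W^2: the bound for f at the
   radius W, with no loss. *)
Lemma jet_comp rho r x (g : V -> C) (f L' : C -> C) L wg w :
  wg <= r -> jet rho x g L wg -> jet r (g x) f L' w ->
  jet rho x (fun y => f (g y)) (fun h => L' (L h)) w.
Proof.
move=> wr jg [_ lf [b' [c' [b0' c0' bc' Lb' fc']]]].
have [r0 lg [b [c [b0 c0 bc Lb gc]]]] := jg.
split=> // [a u v|]; first by rewrite lg lf.
have r0' := ltW r0.
exists (b' * b), (b' * c + c' * (b + c * rho) ^+ 2); split.
- by rewrite mulr_ge0.
- by rewrite !(addr_ge0, mulr_ge0, exprn_ge0).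
- apply: le_trans bc'.
  have -> : b' * b * rho + (b' * c + c' * (b + c * rho) ^+ 2) * rho ^+ 2
    = b' * (b * rho + c * rho ^+ 2) + c' * (b * rho + c * rho ^+ 2) ^+ 2 by ring.
  have bcr : b * rho + c * rho ^+ 2 <= r by apply: le_trans wr.
  apply: lerD; apply: ler_wpM2l => //.
  have q0 : 0 <= b * rho + c * rho ^+ 2 by rewrite addr_ge0// mulr_ge0// exprn_ge0.
  by rewrite lerXn2r// nnegrE (le_trans q0).
- by move=> h; rewrite (le_trans (Lb' _))// -mulrA ler_wpM2l.
move=> h hr; have t0 := nrm_ge0 h.
have vr : nrm (g (x + h) - g x) <= r by rewrite (le_trans (jet_variation jg hr)).
have vb : nrm (g (x + h) - g x) <= (b + c * rho) * nrm h.
  rewrite -[g (x + h) - g x](subrK (L h)) (le_trans (nrmD _ _))// addrC mulrDl lerD//.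
  by rewrite (le_trans (gc h hr))// -mulrA ler_wpM2l// expr2 ler_wpM2r.
have := fc' _ vr; rewrite [g x + _]addrC subrK => hc.
have e : L' (g (x + h) - g x) = L' (L h) + L' (g (x + h) - g x - L h).
  have := lf 1 (L h) (g (x + h) - g x - L h); rewrite mul1r => <-; congr L'.
  by rewrite scale1r; ring.
have -> : f (g (x + h)) - f (g x) - L' (L h)
  = L' (g (x + h) - g x - L h) + (f (g (x + h)) - f (g x) - L' (g (x + h) - g x)).
  by rewrite e; ring.
rewrite (le_trans (nrmD _ _))// mulrDl; apply: lerD.
  by rewrite (le_trans (Lb' _))// -mulrA ler_wpM2l// gc.
rewrite (le_trans hc)// -mulrA ler_wpM2l// -exprMn lerXn2r// nnegrE ?nrm_ge0//.
by rewrite mulr_ge0// addr_ge0// mulr_ge0.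
Qed.

Lemma jet_nbhs_bounded rho x f L w h : jet rho x f L w -> nrm h <= rho ->
  nrm (f (x + h)) <= nrm (f x) + w.
Proof.
move=> j hr; rewrite -[f (x + h)](subrK (f x)) (le_trans (nrmD _ _))// addrC lerD2l.
exact: jet_variation j hr.
Qed.

(** The constants a_i, b_i, c_i of the summands are summed separately; each of the
   three sums is controlled by the sum of the norms a_i + b_i rho + c_i rho^2. *)
Lemma jet_sum (I : choiceType) (f L : I -> V -> C) (w : I -> R) rho x M : 0 < rho ->
  (forall i, jet rho x (f i) (L i) (w i)) -> bsum (fun i => nrm (f i x) + w i) M ->
  exists2 w', jet rho x (fun y => sum (fun i => f i y)) (fun h => sum (fun i => L i h)) w' &
    nrm (sum (fun i => f i x)) + w' <= M.
Proof.
move=> r0 fL wM.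
have /choice[bc bcP] : forall i, exists p : R * R, [/\ 0 <= p.1, 0 <= p.2,
    p.1 * rho + p.2 * rho ^+ 2 <= w i, forall h, nrm (L i h) <= p.1 * nrm h &
    forall h, nrm h <= rho -> nrm (f i (x + h) - f i x - L i h) <= p.2 * nrm h ^+ 2].
  by move=> i; have [_ _ [b [c H]]] := fL i; exists (b, c).
pose b i := (bc i).1; pose c i := (bc i).2.
have b0 i : 0 <= b i by have [] := bcP i.
have c0 i : 0 <= c i by have [] := bcP i.
have bcw i : b i * rho + c i * rho ^+ 2 <= w i by have [] := bcP i.
have Lb i h : nrm (L i h) <= b i * nrm h by have [_ _ _ ->] := bcP i.
have fc i h : nrm h <= rho -> nrm (f i (x + h) - f i x - L i h) <= c i * nrm h ^+ 2.
  by have [_ _ _ _] := bcP i; apply.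
have r20 : 0 < rho ^+ 2 by rewrite exprn_gt0.
pose a i := nrm (f i x).
have a0 i : 0 <= a i by apply: nrm_ge0.
have w0 i : 0 <= w i by apply: jet_ge0 (fL i).
have br0 i : 0 <= b i * rho by rewrite mulr_ge0// ltW.
have cr0 i : 0 <= c i * rho ^+ 2 by rewrite mulr_ge0// ltW.
have [A [bA hA]] : exists A, bsum a A /\ hassum (fun i => (a i)%:C) A%:C.
  by apply: (bsum_lub (M := M)) => //; apply: le_bsum wM => i; rewrite lerDl.
have [B [bB hB]] : exists A, bsum b A /\ hassum (fun i => (b i)%:C) A%:C.
  apply: (bsum_lub (M := rho^-1 * M)) => //.
  apply: le_bsum (bsumZ _ wM); rewrite ?invr_ge0 ?ltW// => i.
  rewrite mulrC ler_pdivlMr//.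
  by move: (bcw i) (cr0 i) (a0 i); rewrite /a; lra.
have [K [bK hK]] : exists A, bsum c A /\ hassum (fun i => (c i)%:C) A%:C.
  apply: (bsum_lub (M := (rho ^+ 2)^-1 * M)) => //.
  apply: le_bsum (bsumZ _ wM); rewrite ?invr_ge0 ?ltW// => i.
  rewrite mulrC ler_pdivlMr//.
  by move: (bcw i) (br0 i) (a0 i); rewrite /a; lra.
have hL h : hassum (fun i => L i h) (sum (fun i => L i h)).
  apply: (bsum_hassum_sum (M := nrm h * B)); apply: le_bsum (bsumZ (nrm_ge0 h) bB).
  by move=> i; rewrite mulrC.
have hf h : nrm h <= rho -> hassum (fun i => f i (x + h)) (sum (fun i => f i (x + h))).
  move=> hr; apply: (bsum_hassum_sum (M := M)); apply: le_bsum wM => i.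
  exact: jet_nbhs_bounded (fL i) hr.
have hf0 : hassum (fun i => f i x) (sum (fun i => f i x)).
  by have := hf 0; rewrite addr0 nrm0; apply; apply: ltW.
exists (B * rho + K * rho ^+ 2).
  split=> // [k u v|].
    have := hassumD (hassumZ k (hL u)) (hL v); apply: hassum_unique.
    by apply: eq_hassum (hL _) => i /=; have [_ -> _] := fL i.
  exists B, K; split=> //; [exact: bsum_ge0 bB|exact: bsum_ge0 bK| |].
    move=> h; apply: (hassum_nrm_le _ (hL h)); rewrite mulrC.
    by apply: le_bsum (bsumZ (nrm_ge0 h) bB) => i; rewrite mulrC.
  move=> h hr; apply: (hassum_nrm_le _ (hassumB (hassumB (hf h hr) hf0) (hL h))).
  rewrite mulrC; apply: le_bsum (bsumZ (exprn_ge0 2 (nrm_ge0 h)) bK) => i.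
  by rewrite mulrC fc.
have h1 : nrm (sum (fun i => f i x)) <= A by apply: hassum_nrm_le hf0.
rewrite (le_trans (lerD h1 (lexx _)))//.
have := hassumD hA (hassumD (hassumZ rho%:C hB) (hassumZ (rho ^+ 2)%:C hK)).
move=> /(hassum_nrm_le _) h2.
have -> : A + (B * rho + K * rho ^+ 2) = nrm (A%:C + (rho%:C * B%:C + (rho ^+ 2)%:C * K%:C)).
  rewrite -!rmorphM -!rmorphD/= nrm_real ger0_norm; first by ring.
  by rewrite addr_ge0 ?(bsum_ge0 bA)// addr_ge0// mulr_ge0 ?(bsum_ge0 bB) ?(bsum_ge0 bK)// ltW.
apply: h2; apply: le_bsum wM => i.
rewrite -!rmorphM -!rmorphD/= nrm_real ger0_norm.
  by rewrite lerD2l mulrC [_ ^+ 2 * _]mulrC.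
by rewrite addr_ge0// addr_ge0// mulrC.
Qed.

Lemma jet_differentiable rho x f L w : jet rho x f L w -> differentiable f x.
Proof.
move=> [r0 lin [b [c [b0 c0 bc Lb fc]]]].
pose LL := GRing.isLinear.Build C V C *:%R L lin.
pose Lf : {linear V -> C} := HB.pack L LL.
have Lfc : continuous Lf.
  apply/linear_bounded_continuous/linear_boundedP.
  exists b%:C; split; first by rewrite complex_real.
  move=> M bM h /=; rewrite -nrmE (le_trans _ (ler_wpM2r _ (ltW bM)))//.
  by rewrite -nrmE -rmorphM/= lecR Lb.
have fL : f \o shift x = cst (f x) + Lf +o_ (0 : V) id.
  apply/eqaddoP => e e0; apply/nbhs_nrm.
  have er : e = (complex.Re e)%:C by apply/esym/RRe_real/gtr0_real.
  set e' := complex.Re e in er; have e'0 : 0 < e' by rewrite -ltcR -er.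
  exists (Num.min rho (e' / (c + 1))).
    by rewrite lt_min r0 divr_gt0// ltr_wpDl.
  move=> h; rewrite subr0 lt_min => /andP[h1 h2].
  rewrite -[leLHS]nrmE -nrmE er -rmorphM/= lecR /cst /=.
  have -> : (f \o shift x - (cst (f x) + L)) h = f (x + h) - f x - L h.
    by rewrite -[LHS]/(f (h + x) - (f x + L h)) [h + x]addrC opprD addrA.
  rewrite (le_trans (fc h (ltW h1)))// expr2 mulrA ler_wpM2r ?nrm_ge0//.
  move: h2; rewrite ltr_pdivlMr ?ltr_wpDl// => h2.
  by have := nrm_ge0 h; move: h2; lra.
apply/diff_locallyP; rewrite (diff_unique Lfc fL); by split.
Qed.

Lemma jetN_cst rho x (k : C) : 0 < rho -> jetN rho x (fun=> k) (nrm k).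
Proof. by move=> r0; exists (fun=> 0), 0; split; [exact: jet_cst|rewrite addr0]. Qed.

Lemma jetNM rho x f g M N : jetN rho x f M -> jetN rho x g N ->
  jetN rho x (fun y => f y * g y) (M * N).
Proof.
move=> [L [w [j hM]]] [L' [w' [j' hN]]]; eexists; eexists; split; first exact: jetM j j'.
have := jet_ge0 j; have := jet_ge0 j'; have := nrm_ge0 (f x); have := nrm_ge0 (g x) => *.
rewrite nrmM; apply: (@le_trans _ _ ((nrm (f x) + w) * (nrm (g x) + w'))).
  by rewrite le_eqVlt; apply/orP; left; apply/eqP; ring.
by rewrite ler_pM// addr_ge0.
Qed.

Lemma jetN_le rho x f M M' : M <= M' -> jetN rho x f M -> jetN rho x f M'.
Proof. by move=> h [L [w [j hM]]]; exists L, w; split=> //; apply: le_trans h. Qed.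

Lemma jetN_prod rho x d (f : 'I_d -> V -> C) (M : 'I_d -> R) : 0 < rho ->
  (forall j, jetN rho x (f j) (M j)) ->
  jetN rho x (fun y => \prod_(j < d) f j y) (\prod_(j < d) M j).
Proof.
move=> r0; elim: d f M => [|d ih] f M fM.
  rewrite big_ord0 -(nrm1 R).
  under eq_fun do rewrite big_ord0; exact: jetN_cst.
rewrite big_ord_recl; under eq_fun do rewrite big_ord_recl.
by apply: jetNM => //; apply: ih => j.
Qed.

Lemma jetN_sum (I : choiceType) (f : I -> V -> C) (m : I -> R) rho x M : 0 < rho ->
  (forall i, jetN rho x (f i) (m i)) -> bsum m M ->
  jetN rho x (fun y => sum (fun i => f i y)) M.
Proof.
move=> r0 fm mM.
have /choice[Lw LwP] : forall i, exists p : (V -> C) * R,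
    jet rho x (f i) p.1 p.2 /\ nrm (f i x) + p.2 <= m i.
  by move=> i; have [L [w H]] := fm i; exists (L, w).
have [|w j h] := jet_sum r0 (fun i => (LwP i).1) (M := M).
  by apply: le_bsum mM => i; apply: (LwP i).2.
by exists (fun h => sum (fun i => (Lw i).1 h)), w.
Qed.

Lemma jetN_shrink rho rho' x f M : 0 < rho' <= rho -> jetN rho x f M -> jetN rho' x f M.
Proof.
by move=> rr [L [w [j h]]]; exists L, w; split=> //; apply: jet_shrinkW j.
Qed.

Lemma jetN_bound rho x f M : jetN rho x f M -> nrm (f x) <= M.
Proof. by move=> [L [w [j]]]; apply: le_trans; rewrite lerDl (jet_ge0 j). Qed.

End OneSpace.

Lemma jet_inv (z : C) (r : R) : 0 < r < nrm z ->
  jet r z (fun y => y^-1) (fun h => - h / z ^+ 2)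
    (r / nrm z ^+ 2 + r ^+ 2 / (nrm z ^+ 2 * (nrm z - r))).
Proof.
move=> /andP[r0 rz]; have z0 : 0 < nrm z by apply: lt_trans rz.
have zn : z != 0 by rewrite -nrm_gt0.
have d0 : 0 < nrm z - r by rewrite subr_gt0.
have z20 : 0 < nrm z ^+ 2 by rewrite exprn_gt0.
split=> // [a u v|]; first by rewrite -[a *: u]/(a * u); ring.
exists (nrm z ^+ 2)^-1, (nrm z ^+ 2 * (nrm z - r))^-1; split.
- by rewrite invr_ge0 ltW.
- by rewrite invr_ge0 ltW// mulr_gt0.
- by rewrite mulrC [_^-1 * r ^+ 2]mulrC.
- by move=> h; rewrite nrmM nrmN nrmV nrmX mulrC.
move=> h hr.
have zh : nrm z - r <= nrm (z + h).
  have := nrmB (z + h) h; rewrite addrK; move: hr; lra.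
have zhn : z + h != 0 by rewrite -nrm_gt0; apply: lt_le_trans zh.
have -> : (z + h)^-1 - z^-1 - - h / z ^+ 2 = h ^+ 2 / (z ^+ 2 * (z + h)).
  by field; rewrite zn zhn.
rewrite nrmM nrmX nrmV nrmM nrmX mulrC ler_wpM2r ?exprn_ge0 ?nrm_ge0//.
by rewrite lef_pV2 ?posrE ?mulr_gt0// ?ler_pM2l//; apply: lt_le_trans zh.
Qed.

(** The bound involves m only; it is thus uniform over the infinite family of
   denominators 1 - q^(n+z). *)
Lemma jetN_inv (V : normedModType C) rho (x : V) f L w m : 0 < m ->
  2 * m <= nrm (f x) -> jet rho x f L w -> w <= m ->
  jetN rho x (fun y => (f y)^-1) (m^-1).
Proof.
move=> m0 mf j wm.
have mf' : m < nrm (f x) by move: mf m0; lra.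
have j' := @jet_inv (f x) m; rewrite m0 mf' in j'; have {}j' := j' isT.
eexists; eexists; split; first exact: jet_comp wm j j'.
rewrite nrmV; set F := nrm (f x) in mf mf' *.
have F0 : 0 < F by apply: lt_trans mf'.
have d0 : 0 < F - m by rewrite subr_gt0.
have -> : F^-1 + (m / F ^+ 2 + m ^+ 2 / (F ^+ 2 * (F - m))) = (F - m)^-1.
  by field; rewrite !gt_eqF.
by rewrite lef_pV2 ?posrE//; move: mf; lra.
Qed.

End Jets.

(** * The complex exponential *)

Section ComplexExponential.
Variable R : realType.
Local Notation C := R[i].

Definition cexp (z : C) : C :=
  (expR (complex.Re z))%:C * (cos (complex.Im z) +i* sin (complex.Im z)).

Lemma rpowcE (x : R) (z : C) : rpowc x z = cexp ((ln x)%:C * z).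
Proof. by case: z => a b; rewrite /rpowc /cexp /= !mul0r subr0 addr0 ![ln x * _]mulrC. Qed.

Lemma cexpD (z w : C) : cexp (z + w) = cexp z * cexp w.
Proof.
case: z w => [a b] [a' b']; rewrite /cexp /= expRD cosD sinD.
apply/eqP; rewrite eq_complex /=; apply/andP; split; apply/eqP; ring.
Qed.

Lemma cexp_real (x : R) : cexp x%:C = (expR x)%:C.
Proof. by rewrite /cexp /= cos0 sin0 -[1 +i* 0]/(1%:C) mulr1. Qed.

Lemma cexp0 : cexp 0 = 1.
Proof. by rewrite -[0]/((0 : R)%:C) cexp_real expR0. Qed.

Lemma nrm_cexp (z : C) : nrm (cexp z) = expR (complex.Re z).
Proof.
rewrite /cexp nrmM nrm_real ger0_norm ?expR_ge0// -[RHS]mulr1; congr (_ * _).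
by apply: complexI; rewrite nrmE normc_def /= cos2Dsin2 sqrtr1.
Qed.

Lemma cexp_neq0 (z : C) : cexp z != 0.
Proof. by rewrite -nrm_gt0 nrm_cexp expR_gt0. Qed.

Lemma cexpN (z : C) : cexp (- z) = (cexp z)^-1.
Proof.
apply: (mulIf (cexp_neq0 z)); rewrite mulVf ?cexp_neq0// -cexpD addNr.
exact: cexp0.
Qed.

Lemma cexpMn (z : C) n : cexp (n%:R * z) = cexp z ^+ n.
Proof.
elim: n => [|n ih]; first by rewrite mul0r cexp0.
by rewrite exprS -ih -cexpD -natr1 mulrDl mul1r addrC.
Qed.

Lemma cexp_sum (I : Type) (r : seq I) (P : pred I) (F : I -> C) :
  cexp (\sum_(i <- r | P i) F i) = \prod_(i <- r | P i) cexp (F i).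
Proof. by elim/big_rec2: _ => [|i y x _ <-]; rewrite ?cexp0 ?cexpD. Qed.

(** These first-order bounds follow from the mean value theorem, each from the
   previous one. *)
Lemma norm_sin_le (y : R) : `|sin y| <= `|y|.
Proof.
wlog y0 : y / 0 <= y.
  move=> h; have [/h//|/ltW y0] := leP 0 y.
  by rewrite -(normrN y) -(normrN (sin y)) -sinN h// oppr_ge0.
have [c _] := @MVT_segment R sin cos 0 y y0 (fun x _ => is_derive_sin x)
  (continuous_subspaceT (@continuous_sin R)).
rewrite sin0 !subr0 => ->; by rewrite normrM ler_piMl// cos_max.
Qed.

Lemma norm_cos1_le (y : R) : `|cos y - 1| <= y ^+ 2 /\ `|cos y - 1| <= `|y|.
Proof.
wlog y0 : y / 0 <= y.
  move=> h; have [/h//|/ltW y0] := leP 0 y.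
  by have := h (- y); rewrite oppr_ge0 cosN sqrrN normrN; apply.
have [c cy] := @MVT_segment R cos (fun x => - sin x) 0 y y0 (fun x _ => is_derive_cos x)
  (continuous_subspaceT (@continuous_cos R)).
rewrite cos0 subr0 => ->; rewrite normrM normrN (ger0_norm y0).
have : `|sin c| <= y.
  move: cy; rewrite in_itv/= => /andP[c0 cy].
  by rewrite (le_trans (norm_sin_le c))// ger0_norm.
by move=> h; split; [rewrite expr2 ler_wpM2r|rewrite ler_piMl// sin_max].
Qed.

Lemma norm_sinB_le (y : R) : `|sin y - y| <= y ^+ 2.
Proof.
wlog y0 : y / 0 <= y.
  move=> h; have [/h//|/ltW y0] := leP 0 y.
  by have := h (- y); rewrite oppr_ge0 sinN sqrrN -opprD normrN; apply.
have df (x : R) : is_derive x (1 : R) (fun z : R => sin z - z) (cos x - 1).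
  exact: is_deriveB.
have [|c cy] := @MVT_segment R (fun z => sin z - z) (fun z => cos z - 1) 0 y y0 (fun x _ => df x).
  apply: continuous_subspaceT => x; apply: cvgB; last exact: cvg_id.
  exact: continuous_sin.
rewrite sin0 !subr0 => ->; rewrite normrM (ger0_norm y0) expr2 ler_wpM2r//.
move: cy; rewrite in_itv/= => /andP[c0 cy].
by rewrite (le_trans (norm_cos1_le c).2)// ger0_norm.
Qed.

(** The upper bound comes from exp(-x) >= 1 - x, that is exp x <= 1/(1 - x). *)
Lemma expR_quadratic (x : R) : x <= 1 / 2 -> `|expR x - 1 - x| <= 2 * x ^+ 2.
Proof.
move=> x2; have h1 := expR_ge1Dx x; have h2 := expR_ge1Dx (- x).
rewrite ger0_norm; last by move: h1; lra.
have e0 := expR_gt0 x.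
have : (1 - x) * expR x <= 1.
  by rewrite -[leRHS](expRxMexpNx_1 x) mulrC ler_pM2l.
have x0 : 0 < 1 - x by move: x2; lra.
rewrite -ler_pdivlMl// => h; rewrite -addrA -opprD lerBlDr (le_trans h)// mulr1.
rewrite -[leLHS]mul1r ler_pdivrMr//.
have : 0 <= x ^+ 2 by rewrite sqr_ge0.
by move: x2; nra.
Qed.

Lemma cexp_quadratic (h : C) : nrm h <= 1 / 2 ->
  nrm (cexp h - 1 - h) <= 8 * nrm h ^+ 2.
Proof.
move=> hn; rewrite (le_trans (nrm_le_ReIm _))//.
have xh := nrm_Re h; have yh := nrm_Im h.
case: h hn xh yh => x y /= hn xh yh; rewrite /cexp /=.
set N := nrm _ in hn xh yh *.
have x2 : x <= 1 / 2 by rewrite (le_trans (ler_norm _))// (le_trans xh).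
have ex : expR x <= 2.
  have := expR_quadratic x2; rewrite ler_norml => /andP[_].
  have : `|x| <= 1/2 by rewrite (le_trans xh).
  rewrite ler_norml => /andP[]; nra.
have e0 := expR_ge0 x.
have xx : x ^+ 2 <= N ^+ 2.
  rewrite -(ger0_norm (sqr_ge0 x)) normrX lerXn2r// nnegrE.
  by rewrite (le_trans (normr_ge0 x)).
have yy : y ^+ 2 <= N ^+ 2.
  rewrite -(ger0_norm (sqr_ge0 y)) normrX lerXn2r// nnegrE.
  by rewrite (le_trans (normr_ge0 x)).
have N0 : 0 <= N by apply: nrm_ge0.
have ex1 : `|expR x - 1| <= 2 * N.
  rewrite -[_ - 1](subrK x) (le_trans (ler_normD _ _))//.
  have := expR_quadratic x2; have : N ^+ 2 <= N * (1 / 2) by rewrite expr2 ler_wpM2l.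
  by move: xh xx; lra.
have [c1 _] := norm_cos1_le y; have s1 := norm_sinB_le y.
have -> : expR x * cos y - 0 * sin y + - 1 - x = (expR x - 1 - x) + expR x * (cos y - 1) by ring.
have -> : expR x * sin y + 0 * cos y + - 0 - y = expR x * (sin y - y) + (expR x - 1) * y by ring.
have b1 : `|(expR x - 1 - x) + expR x * (cos y - 1)| <= 2 * N ^+ 2 + 2 * N ^+ 2.
  rewrite (le_trans (ler_normD _ _))// lerD//.
    by rewrite (le_trans (expR_quadratic x2))// ler_wpM2l.
  by rewrite normrM ger0_norm// ler_pM// (le_trans c1).
have b2 : `|expR x * (sin y - y) + (expR x - 1) * y| <= 2 * N ^+ 2 + 2 * N ^+ 2.
  rewrite (le_trans (ler_normD _ _))// lerD//.
    by rewrite normrM ger0_norm// ler_pM// (le_trans s1).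
  by rewrite normrM expr2 mulrA ler_pM.
by apply: (le_trans (lerD b1 b2)); rewrite le_eqVlt; apply/orP; left; apply/eqP; ring.
Qed.

Lemma jet_cexp (z : C) : jet (1 / 2) z cexp (fun h => cexp z * h) (3 * nrm (cexp z)).
Proof.
have k0 := nrm_ge0 (cexp z).
split=> // [a u v|]; first by rewrite -[a *: u]/(a * u); ring.
exists (nrm (cexp z)), (nrm (cexp z) * 8); split=> //.
- by rewrite mulr_ge0.
- by rewrite expr2; lra.
- by move=> h; rewrite nrmM.
move=> h hr; rewrite cexpD.
have -> : cexp z * cexp h - cexp z - cexp z * h = cexp z * (cexp h - 1 - h) by ring.
by rewrite nrmM -mulrA ler_wpM2l// cexp_quadratic.
Qed.

(** The radius and the bound are forgotten; the linear part is what a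
   differential equation speaks of. *)
Definition has_linear_part (V : normedModType C) (x : V) (f L : V -> C) :=
  exists rho w, jet rho x f L w.

Definition holo (V : normedModType C) (x : V) (f : V -> C) := exists L, has_linear_part x f L.

Lemma min_shrink (r1 r2 : R) : 0 < r1 -> 0 < r2 ->
  0 < Num.min r1 r2 <= r1 /\ 0 < Num.min r1 r2 <= r2.
Proof. by move=> h1 h2; rewrite !lt_min h1 h2 !ge_min !lexx orbT. Qed.

Section Holo.
Variable V : normedModType C.
Implicit Types (x : V) (f g L : V -> C).

Lemma holo_jetN x f : holo x f -> exists rho M, 0 < rho /\ jetN rho x f M.
Proof.
move=> [L [rho [w j]]]; exists rho, (nrm (f x) + w).
by split; [case: j|exists L, w].
Qed.

Lemma linear_part_cst x k : has_linear_part x (fun=> k) (fun=> 0).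
Proof. by exists 1, 0; apply: jet_cst. Qed.

Lemma linear_partM x f g L L' : has_linear_part x f L -> has_linear_part x g L' ->
  has_linear_part x (fun y => f y * g y) (fun h => f x * L' h + g x * L h).
Proof.
move=> [r [w j]] [r' [w' j']]; have r0 : 0 < r by case: j.
have r0' : 0 < r' by case: j'.
have [m1 m2] := min_shrink r0 r0'.
by do 2!eexists; exact: jetM (jet_shrinkW m1 j) (jet_shrinkW m2 j').
Qed.

Lemma linear_partD x f g L L' : has_linear_part x f L -> has_linear_part x g L' ->
  has_linear_part x (fun y => f y + g y) (fun h => L h + L' h).
Proof.
move=> [r [w j]] [r' [w' j']]; have r0 : 0 < r by case: j.
have r0' : 0 < r' by case: j'.
have [m1 m2] := min_shrink r0 r0'.
by do 2!eexists; exact: jetD (jet_shrinkW m1 j) (jet_shrinkW m2 j').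
Qed.

Lemma linear_part_comp x g L (f L' : C -> C) :
  has_linear_part x g L -> has_linear_part (g x) f L' ->
  has_linear_part x (fun y => f (g y)) (fun h => L' (L h)).
Proof.
move=> [r [w j]] [r' [w' j']]; have r0' : 0 < r' by case: j'.
have [s s0 hs] := jet_small r0' j.
have s0' : 0 < s <= s by case/andP: s0 => ->; rewrite lexx.
by do 2!eexists; exact: jet_comp (lexx _) (hs _ s0') j'.
Qed.

Lemma linear_part_affine x f L b : 0 <= b ->
  (forall a u v, L (a *: u + v) = a * L u + L v) ->
  (forall h, nrm (L h) <= b * nrm h) ->
  (forall h, f (x + h) = f x + L h) -> has_linear_part x f L.
Proof. by move=> b0 lin Lb fL; exists 1, (b * 1); apply: jet_affine. Qed.

Lemma holo_cst x k : holo x (fun=> k).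
Proof. by eexists; exact: linear_part_cst. Qed.

Lemma holoM x f g : holo x f -> holo x g -> holo x (fun y => f y * g y).
Proof. by move=> [L h] [L' h']; eexists; exact: linear_partM h h'. Qed.

Lemma holoD x f g : holo x f -> holo x g -> holo x (fun y => f y + g y).
Proof. by move=> [L h] [L' h']; eexists; exact: linear_partD h h'. Qed.

Lemma holoN x f : holo x f -> holo x (fun y => - f y).
Proof.
by move=> /(holoM (holo_cst x (-1))); under eq_fun do rewrite mulN1r.
Qed.

Lemma holo_comp x g (f : C -> C) : holo x g -> holo (g x) f -> holo x (fun y => f (g y)).
Proof. by move=> [L h] [L' h']; eexists; exact: linear_part_comp h h'. Qed.

Lemma holo_eq x f g : (exists2 e : R, 0 < e & forall y, nrm (y - x) < e -> f y = g y) ->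
  holo x f -> holo x g.
Proof.
move=> [e e0 fg] [L [r [w j]]]; have r0 : 0 < r by case: j.
exists L, (Num.min r (e / 2)), w.
have e2 : 0 < e / 2 by rewrite divr_gt0.
have [m1 m2] := min_shrink r0 e2.
apply: (jet_eq _ (jet_shrinkW m1 j)) => h hr; apply: fg.
rewrite addrC addKr; case/andP: m2 => _ m2.
by rewrite (le_lt_trans hr)// (le_lt_trans m2)// ltr_pdivrMr// ltr_pMr// ltr1n.
Qed.

Lemma holo_inv x f : holo x f -> f x != 0 -> holo x (fun y => (f y)^-1).
Proof.
move=> hf fx; apply: (holo_comp (f := fun y => y^-1)) => //.
have n0 : 0 < nrm (f x) by rewrite nrm_gt0.
do 3!eexists; apply: (jet_inv (r := nrm (f x) / 2) _).
by rewrite divr_gt0// ltr_pdivrMr// ltr_pMr// ltr1n.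
Qed.

Lemma holo_cont x f (e : R) : holo x f -> 0 < e ->
  exists2 d : R, 0 < d & forall y, nrm (y - x) < d -> nrm (f y - f x) < e.
Proof.
move=> [L [r [w j]]] e0.
have e2 : 0 < e / 2 by rewrite divr_gt0.
have [s s0 hs] := jet_small e2 j; have s0' : 0 < s <= s by case/andP: s0 => ->; rewrite lexx.
exists s; first by case/andP: s0.
move=> y ys; have := jet_variation (hs _ s0') (ltW ys).
rewrite [x + _]addrC subrK => /le_lt_trans; apply.
by rewrite ltr_pdivrMr// ltr_pMr// ltr1n.
Qed.

Lemma holo_differentiable x f : holo x f -> differentiable f x.
Proof. by move=> [L [r [w j]]]; apply: jet_differentiable j. Qed.

Lemma holo_prod x (I : Type) (r : seq I) (P : pred I) (f : I -> V -> C) :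
  (forall i, P i -> holo x (f i)) -> holo x (fun y => \prod_(i <- r | P i) f i y).
Proof.
move=> hf; elim: r => [|i r ih].
  have -> : (fun y => \prod_(i <- [::] | P i) f i y) = (fun=> 1).
    by apply/funext => y; rewrite big_nil.
  exact: holo_cst.
have -> : (fun y => \prod_(j <- i :: r | P j) f j y) = fun y =>
    (if P i then f i y else 1) * \prod_(j <- r | P j) f j y.
  by apply/funext => y; rewrite big_cons; case: ifP; rewrite ?mul1r.
apply: holoM => //; case Pi: (P i); [exact: hf|exact: holo_cst].
Qed.

Lemma holo_sum x (I : Type) (r : seq I) (P : pred I) (f : I -> V -> C) :
  (forall i, P i -> holo x (f i)) -> holo x (fun y => \sum_(i <- r | P i) f i y).
Proof.
move=> hf; elim: r => [|i r ih].
  have -> : (fun y => \sum_(i <- [::] | P i) f i y) = (fun=> 0).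
    by apply/funext => y; rewrite big_nil.
  exact: holo_cst.
have -> : (fun y => \sum_(j <- i :: r | P j) f j y) = fun y =>
    (if P i then f i y else 0) + \sum_(j <- r | P j) f j y.
  by apply/funext => y; rewrite big_cons; case: ifP; rewrite ?add0r.
apply: holoD => //; case Pi: (P i); [exact: hf|exact: holo_cst].
Qed.

End Holo.

Lemma linear_part_id (z : C) : has_linear_part z (fun w => w) (fun h => h).
Proof. by apply: (@linear_part_affine _ _ _ _ 1) => // h; rewrite mul1r. Qed.

Lemma holo_id (z : C) : holo z (fun w => w).
Proof. by eexists; exact: linear_part_id. Qed.

Lemma linear_part_cexp (z : C) : has_linear_part z cexp (fun h => cexp z * h).
Proof. by do 2!eexists; exact: jet_cexp. Qed.

Lemma holo_cexp (z : C) : holo z cexp.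
Proof. by eexists; exact: linear_part_cexp. Qed.

(** The singularity at 0 is removed by hand: the reciprocal of this function
   carries the regular part of 1/(1 - q^z) at its poles. *)
Definition expm1_div (w : C) : C := if w == 0 then 1 else (cexp w - 1) / w.

Local Notation psi := expm1_div.

Lemma expm1_divE (w : C) : w * psi w = cexp w - 1.
Proof.
rewrite /psi; case: eqVneq => [->|w0]; first by rewrite cexp0 mul0r subrr.
by rewrite mulrC divfK.
Qed.

Lemma expm1_div0 : psi 0 = 1.
Proof. by rewrite /psi eqxx. Qed.

Lemma expm1_div_near1 (w : C) : nrm w <= 1 / 2 -> nrm (psi w - 1) <= 8 * nrm w.
Proof.
move=> hw; have [->|w0] := eqVneq w 0.
  by rewrite expm1_div0 subrr nrm0 mulr0.
have n0 : 0 < nrm w by rewrite nrm_gt0.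
rewrite -(ler_pM2l n0) -nrmM mulrBr expm1_divE mulr1 (le_trans (cexp_quadratic hw))//.
by rewrite expr2 mulrCA mulrA.
Qed.

(** From e^w - 1 = (e^(w/2) - 1)(e^(w/2) + 1). *)
Lemma expm1_div_half (w : C) : psi w - psi (w / 2) = w / 4 * psi (w / 2) ^+ 2.
Proof.
have [->|w0] := eqVneq w 0; first by rewrite !mul0r subrr.
apply: (mulfI w0); rewrite mulrBr expm1_divE.
have := expm1_divE (w / 2); set p := psi _ => hp.
have -> : cexp w = cexp (w / 2) ^+ 2 by rewrite -cexpMn mulrC divfK// pnatr_eq0.
have -> : cexp (w / 2) = 1 + w / 2 * p by rewrite hp; ring.
by field.
Qed.

(** Taylor expansion of (e^w - 1)/w at 0. Summing the identity
   psi w - psi (w/2) = (w/4) psi(w/2)^2 over the successive halves of w gives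
   w/2 + O(w^2), and needs no more than the estimate psi w = 1 + O(w). *)
Lemma expm1_div_quadratic (w : C) : nrm w <= 1 / 2 ->
  nrm (psi w - 1 - w / 2) <= 6 * nrm w ^+ 2.
Proof.
pose D z := psi z - 1 - z / 2; rewrite -/(D w).
have n2 (z : C) : nrm (z / 2) = nrm z / 2 by rewrite nrmM nrmV nrm_nat.
have step z : nrm z <= 1 / 2 -> nrm (D z) <= nrm (D (z / 2)) + 4 * nrm z ^+ 2.
  move=> hz; have z0 := nrm_ge0 z.
  have e : D z - D (z / 2) = z / 4 * ((psi (z / 2) - 1) * (psi (z / 2) - 1 + 2)).
    have -> : D z - D (z / 2) = (psi z - psi (z / 2)) - z / 4 by rewrite /D; field.
    by rewrite expm1_div_half; ring.
  rewrite -[D z](subrK (D (z / 2))) (le_trans (nrmD _ _))// addrC lerD2l e.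
  have hz2 : nrm (z / 2) <= 1 / 2 by rewrite n2; lra.
  have := expm1_div_near1 hz2; set p := psi _ - 1 => hp.
  rewrite nrmM nrmM nrmM nrmV nrm_nat.
  have hp' : nrm p <= 4 * nrm z by move: hp; rewrite n2; lra.
  have hp2 : nrm (p + 2) <= 4.
    by rewrite (le_trans (nrmD _ _))// nrm_nat; move: hp'; lra.
  have := ler_pM (nrm_ge0 p) (nrm_ge0 (p + 2)) hp' hp2 => h.
  apply: (le_trans (ler_wpM2l _ h)); first by rewrite divr_ge0.
  by rewrite le_eqVlt; apply/orP; left; apply/eqP; field.
have iter n z : nrm z <= 1 / 2 -> nrm (D z) <= nrm (D (z / 2 ^+ n)) + 6 * nrm z ^+ 2.
  elim: n z => [|n ih] z hz; first by rewrite expr0 divr1 lerDl mulr_ge0// exprn_ge0// nrm_ge0.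
  have hz2 : nrm (z / 2) <= 1 / 2 by move: hz (nrm_ge0 z); rewrite n2; lra.
  rewrite (le_trans (step z hz))//; have := ih _ hz2.
  have -> : z / 2 ^+ n.+1 = z / 2 / 2 ^+ n by rewrite [_ ^+ n.+1]exprS invfM mulrA.
  have := sqr_ge0 (nrm z); rewrite n2 expr_div_n.
  rewrite (_ : (2 : R) ^+ 2 = 4); last by ring.
  by lra.
move=> hw; apply/ler_addgt0Pr => e e0.
have w0 := nrm_ge0 w.
have e9 : 0 < e / 9 by rewrite divr_gt0.
have half : 0 <= (1 / 2 : R) < 1 by lra.
have [N hN] := expr_lt_eventually half e9.
apply: (le_trans (iter N w hw)); rewrite addrC lerD2l.
have lN : (1 / 2 : R) ^+ N < e / 9 by apply: hN.
pose v := w / 2 ^+ N; rewrite -/v.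
have nv : nrm v = nrm w * (1 / 2) ^+ N.
  by rewrite /v nrmM nrmV nrmX nrm_nat expr_div_n expr1n mul1r.
have p0 : 0 <= (1 / 2 : R) ^+ N by rewrite exprn_ge0.
have p1 : (1 / 2 : R) ^+ N <= 1 by rewrite exprn_ile1//; lra.
have hv : nrm v <= 1 / 2 * (1 / 2) ^+ N by rewrite nv ler_wpM2r.
have hv2 : nrm v <= 1 / 2 by rewrite (le_trans hv)//; move: p1; lra.
rewrite /D (le_trans (nrmB _ _))// n2; have := expm1_div_near1 hv2.
by move: hv lN; lra.
Qed.

Lemma holo_expm1_div (z : C) : holo z psi.
Proof.
have [->|z0] := eqVneq z 0.
  suff j : jet (1 / 2) (0 : C) psi (fun h => h / 2) 2 by exists (fun h => h / 2), (1 / 2), 2.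
  split.
  - lra.
  - by move=> a u v; rewrite -[a *: u]/(a * u); ring.
  exists (1 / 2), 6; split=> //; [by rewrite expr2; lra| |].
    by move=> h; rewrite nrmM nrmV nrm_nat mul1r mulrC.
  by move=> h hr; rewrite add0r expm1_div0 expm1_div_quadratic.
have n0 : 0 < nrm z by rewrite nrm_gt0.
apply: (@holo_eq _ _ (fun y => (cexp y - 1) * y^-1)).
  exists (nrm z) => // y hy; rewrite /psi; case: eqVneq => // y0.
  by move: hy; rewrite y0 sub0r nrmN ltxx.
apply: holoM; last by apply: holo_inv => //; exact: holo_id.
by apply: holoD; [exact: holo_cexp|exact: holo_cst].
Qed.

Lemma cexp_eq1 (z : C) : cexp z = 1 <-> exists m : int, z = (2 * pi)%:C * 'i%C * m%:~R.
Proof.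
have im (m : int) : (2 * pi)%:C * 'i%C * m%:~R = 0 +i* (m%:~R * (2 * pi)) :> C.
  rewrite -(rmorph_int (real_complex R)); apply/eqP; rewrite eq_complex /=.
  by apply/andP; split; apply/eqP; ring.
have c2 : cexp ((2 * pi)%:C * 'i%C) = 1.
  have := im 1; rewrite mulr1 mul1r => ->.
  by rewrite /cexp /= expR0 mulr_natl cos2pi sin2pi mul1r.
split=> [h|[m ->]]; last first.
  case: m => [n|n]; first by rewrite -pmulrn mulrC cexpMn c2 expr1n.
  by rewrite NegzE mulrNz mulrN cexpN -pmulrn mulrC cexpMn c2 expr1n invr1.
have := nrm_cexp z; rewrite h nrm1 -[in LHS]expR0 => /expR_inj/esym x0.
case: z x0 h => x y /= -> {x}; rewrite /cexp /= expR0 mul1r => -[c1 s0].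
pose m := Num.floor (y / (2 * pi)); exists m; rewrite im; congr (_ +i* _).
have p0 := pi_gt0 R; have p2 : 0 < 2 * pi :> R by rewrite mulr_gt0.
pose y' := y - m%:~R * (2 * pi).
have y'0 : 0 <= y' by rewrite subr_ge0 -ler_pdivlMr// floor_le.
have y'1 : y' < 2 * pi.
  rewrite ltrBlDr -[X in X + _]mul1r -mulrDl -ltr_pdivrMr//.
  by rewrite addrC -[1]/(1%:~R) -intrD floorD1_gt.
have cy' : cos y' = 1.
  have e : cexp (0 +i* y) = cexp (0 +i* y') * cexp (0 +i* (m%:~R * (2 * pi))).
    rewrite -cexpD; congr cexp; apply/eqP; rewrite eq_complex /= addr0 eqxx /=.
    by apply/eqP; rewrite /y'; ring.
  have e1 : cexp (0 +i* (m%:~R * (2 * pi))) = 1.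
    rewrite -im; case: m {y' y'0 y'1 e} => n; first by rewrite -pmulrn mulrC cexpMn c2 expr1n.
    by rewrite NegzE mulrNz mulrN cexpN -pmulrn mulrC cexpMn c2 expr1n invr1.
  move: e; rewrite e1 mulr1 /cexp /= expR0 !mul1r => -[<- _]; exact: c1.
suff : y' = 0 by move=> /eqP; rewrite subr_eq0 => /eqP.
have z0 : (0 : R) \in `[0, pi] by rewrite in_itv/= lexx ltW.
have [yp|yp] := leP y' pi.
  by apply: (@cos_inj R) => //; rewrite ?in_itv/= ?y'0// cy' cos0.
have : 2 * pi - y' = 0.
  apply: (@cos_inj R) => //; first by rewrite in_itv/=; lra.
  by rewrite cosB mulr_natl cos2pi sin2pi cy' cos0 mul0r addr0 mul1r.
by move: y'1; lra.
Qed.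

End ComplexExponential.

(** * Powers of q and the pole lattice *)

Section Lattice.
Variables (R : realType) (q : R).
Hypothesis q01 : 0 < q < 1.
Local Notation C := R[i].
Local Notation L := (pole_lattice q).

Lemma lnq_lt0 : ln q < 0.
Proof. by case/andP: q01 => q0 q1; rewrite ln_lt0// q0. Qed.

Lemma lnqC_neq0 : (ln q)%:C != 0 :> C.
Proof. by rewrite -nrm_gt0 nrm_real normr_gt0 lt_eqF// lnq_lt0. Qed.

Lemma rpowcD (z w : C) : rpowc q (z + w) = rpowc q z * rpowc q w.
Proof. by rewrite !rpowcE mulrDr cexpD. Qed.

Lemma rpowc0 : rpowc q 0 = 1.
Proof. by rewrite rpowcE mulr0 cexp0. Qed.

Lemma rpowc_neq0 (z : C) : rpowc q z != 0.
Proof. by rewrite rpowcE cexp_neq0. Qed.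

Lemma rpowcMn n (z : C) : rpowc q (n%:R * z) = rpowc q z ^+ n.
Proof. by rewrite !rpowcE -cexpMn; congr cexp; ring. Qed.

Lemma rpowc_nat n : rpowc q n%:R = (q ^+ n)%:C.
Proof.
rewrite -[n%:R]mulr1 rpowcMn rpowcE mulr1 cexp_real lnK ?rmorphXn//.
by case/andP: q01.
Qed.

Lemma rpowc_sum (I : Type) (r : seq I) (P : pred I) (F : I -> C) :
  rpowc q (\sum_(i <- r | P i) F i) = \prod_(i <- r | P i) rpowc q (F i).
Proof. by elim/big_rec2: _ => [|i y x _ <-]; rewrite ?rpowc0 ?rpowcD. Qed.

Lemma nrm_rpowc (z : C) : nrm (rpowc q z) = expR (ln q * complex.Re z).
Proof. by rewrite rpowcE nrm_cexp; case: z => a b /=; rewrite mul0r subr0. Qed.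

Lemma holo_rpowc (z : C) : holo z (rpowc q).
Proof.
have -> : rpowc q = fun w => cexp ((ln q)%:C * w) by apply/funext => w; rewrite rpowcE.
apply: (holo_comp (g := fun w => (ln q)%:C * w)) (holo_cexp _).
exists (fun h => (ln q)%:C * h).
apply: (@linear_part_affine _ _ _ _ _ (nrm ((ln q)%:C : C))).
- exact: nrm_ge0.
- by move=> a u v; rewrite -[a *: u]/(a * u); ring.
- by move=> h; rewrite nrmM.
- by move=> h; rewrite mulrDr.
Qed.

(** The lattice is where one of the denominators 1 - q^(n+z) vanishes. *)
Lemma pole_latticeP (z : C) : L z <-> exists n : nat, rpowc q (n%:R + z) = 1.
Proof.
have l0 := lnqC_neq0.
have l0' : ln q != 0 by rewrite lt_eqF// lnq_lt0.
have e (m : int) : (ln q)%:C * ((2 * pi / ln q)%:C * 'i%C * m%:~R) = (2 * pi)%:C * 'i%C * m%:~R.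
  by rewrite mulrA mulrA -rmorphM/= mulrC [ln q * _]mulrC mulfVK// mulrC.
split=> [[n [m ->]]|[n]].
  exists n; rewrite rpowcE; apply/cexp_eq1; exists m.
  by rewrite addrA subrr add0r e.
rewrite rpowcE => /cexp_eq1[m hm]; exists n, m.
apply: (mulfI l0); rewrite mulrDr e -hm; ring.
Qed.

Lemma low_bound_fin (x : nat -> R) N :
  exists2 m : R, 0 < m & forall n, (n < N)%N -> 0 < x n -> m <= x n.
Proof.
elim: N => [|N [m m0 hm]]; first by exists 1.
have [xN|xN] := ltP 0 (x N).
  exists (Num.min m (x N)); first by rewrite lt_min m0.
  move=> n; rewrite ltnS leq_eqVlt => /orP[/eqP ->|nN] h; rewrite ge_min.
    by rewrite lexx orbT.
  by rewrite hm.
exists m => // n; rewrite ltnS leq_eqVlt => /orP[/eqP -> h|]; last exact: hm.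
by move: (lt_le_trans h xN); rewrite ltxx.
Qed.

(** The values q^(n+z) tend to 0, so those different from 1 stay away from 1. *)
Lemma qpow_away (z : C) : exists2 m : R, 0 < m &
  forall n : nat, rpowc q (n%:R + z) <> 1 -> 2 * m <= nrm (1 - rpowc q (n%:R + z)).
Proof.
have u0 : 0 < nrm (rpowc q z) by rewrite nrm_gt0 rpowc_neq0.
have q0 : 0 < q by case/andP: q01.
have q01' : 0 <= q < 1 by case/andP: q01 => h ->; rewrite ltW.
have e0 : 0 < 1 / 2 / nrm (rpowc q z) by rewrite divr_gt0.
have [N hN] := expr_lt_eventually q01' e0.
have [m m0 hm] := low_bound_fin (fun n => nrm (1 - rpowc q (n%:R + z))) N.
exists (Num.min m (1 / 2) / 2); first by rewrite divr_gt0// lt_min m0; lra.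
move=> n hn; rewrite mulrC divfK//.
have [nN|Nn] := ltnP n N.
  rewrite ge_min hm// nrm_gt0 subr_eq0; apply/eqP => h; exact: hn.
have := hN _ Nn; rewrite ltr_pdivlMr// => h.
rewrite ge_min; apply/orP; right.
have : nrm (rpowc q (n%:R + z)) < 1 / 2.
  by rewrite rpowcD rpowc_nat nrmM nrm_real ger0_norm// exprn_ge0// ltW.
have := nrmD (1 - rpowc q (n%:R + z)) (rpowc q (n%:R + z)).
by rewrite subrK nrm1; lra.
Qed.

Lemma qpow_away_near (z : C) : exists2 d : R, 0 < d & forall w, nrm (w - z) < d ->
  forall n : nat, rpowc q (n%:R + z) <> 1 -> rpowc q (n%:R + w) <> 1.
Proof.
have [m m0 hm] := qpow_away z; have [d d0 hd] := holo_cont (holo_rpowc z) m0.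
exists d => // w /hd wz n /hm h e.
have q0 : 0 < q by case/andP: q01.
have q1 : q <= 1 by case/andP: q01 => _ /ltW.
have e' : 1 - rpowc q (n%:R + z) = (q ^+ n)%:C * (rpowc q w - rpowc q z).
  by rewrite mulrBr -rpowc_nat -!rpowcD e.
move: h; rewrite e' nrmM nrm_real.
rewrite ger0_norm; last by rewrite exprn_ge0// ltW.
move=> h; have : q ^+ n * nrm (rpowc q w - rpowc q z) <= nrm (rpowc q w - rpowc q z).
  by rewrite ler_piMl ?nrm_ge0// exprn_ile1//; apply: ltW.
by move: wz m0; lra.
Qed.

Lemma jetN_qpow_inv (z : C) : exists rho M, 0 < rho /\ forall n : nat,
  rpowc q (n%:R + z) <> 1 -> jetN rho z (fun w => (1 - rpowc q (n%:R + w))^-1) M.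
Proof.
have [m m0 hm] := qpow_away z.
have [Lu [r [w j]]] := holo_rpowc z.
have [s s0 hs] := jet_small m0 j; have s0' : 0 < s <= s by case/andP: s0 => ->; rewrite lexx.
have {}j := hs _ s0'; have sp : 0 < s by case/andP: s0.
exists s, m^-1; split=> // n /hm h.
have q0 : 0 < q by case/andP: q01.
have q1 : q <= 1 by case/andP: q01 => _ /ltW.
have jc := jetM (jet_cst z (- (q ^+ n)%:C) sp) j.
have {jc} := jetD (jet_cst z 1 sp) jc.
set w' := (X in jet _ _ _ _ X -> _) => jn.
have e : (fun y : C => 1 + - (q ^+ n)%:C * rpowc q y) = fun y => 1 - rpowc q (n%:R + y).
  by apply/funext => y; rewrite rpowcD rpowc_nat mulNr.
rewrite e in jn; apply: (jetN_inv m0 _ jn) => //.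
rewrite /w' add0r mulr0 mul0r !addr0 nrmN nrm_real ger0_norm; last by rewrite exprn_ge0// ltW.
by rewrite ler_piMl ?exprn_ile1//; apply: ltW.
Qed.

(** w/(1 - q^w), with its value at w = 0. *)
Definition regular_part (w : C) : C := - ((ln q)%:C * expm1_div ((ln q)%:C * w))^-1.

Lemma regular_part_near0 : exists2 d : R, 0 < d & forall w, nrm w < d ->
  [/\ expm1_div ((ln q)%:C * w) != 0, holo w regular_part,
      regular_part w != 0, rpowc q w = 1 -> w = 0
    & regular_part w * (1 - rpowc q w) = w].
Proof.
have l0 : 0 < nrm ((ln q)%:C : C) by rewrite nrm_gt0 lnqC_neq0.
exists ((16 * nrm ((ln q)%:C : C))^-1); first by rewrite invr_gt0 mulr_gt0.
move=> w hw; have hlw : nrm ((ln q)%:C * w) <= 1 / 16.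
  by rewrite nrmM; move: hw; rewrite -div1r ltr_pdivlMr ?mulr_gt0//; lra.
have psi0 : expm1_div ((ln q)%:C * w) != 0.
  apply/eqP => h; have := @expm1_div_near1 R ((ln q)%:C * w).
  rewrite h sub0r nrmN nrm1; move: hlw; lra.
have lpsi0 := mulf_neq0 lnqC_neq0 psi0.
have e : rpowc q w - 1 = (ln q)%:C * w * expm1_div ((ln q)%:C * w) by rewrite expm1_divE rpowcE.
split=> //.
- rewrite /regular_part; apply: holoN; apply: holo_inv => //.
  apply: holoM; first exact: holo_cst.
  apply: (holo_comp (g := fun w => (ln q)%:C * w)); last exact: holo_expm1_div.
  by apply: holoM; [exact: holo_cst|exact: holo_id].
- by rewrite /regular_part oppr_eq0 invr_eq0.
- move=> h; move: e; rewrite h subrr => /esym/eqP.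
  by rewrite mulf_eq0 (negbTE psi0) orbF mulf_eq0 (negbTE lnqC_neq0) => /eqP.
- rewrite -[1 - _]opprB e /regular_part; field.
  by rewrite psi0 lnqC_neq0.
Qed.

(** The factor 1/(1 - q^(n+z)) for z near c, multiplied by z - c if c lies in the
   lattice. In that case exactly one index n gives a kernel that does not vanish at
   z = c. *)
Definition kernel (c : C) (n : nat) (z : C) : C :=
  if `[< L c >] then
    if rpowc q (n%:R + c) == 1 then regular_part (z - c)
    else (z - c) / (1 - rpowc q (n%:R + z))
  else (1 - rpowc q (n%:R + z))^-1.

Lemma kernelN c n z : ~ L c -> kernel c n z = (1 - rpowc q (n%:R + z))^-1.
Proof. by move=> h; rewrite /kernel asboolF. Qed.

Lemma kernel_center c n : L c ->
  kernel c n c = if rpowc q (n%:R + c) == 1 then regular_part 0 else 0.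
Proof. by move=> h; rewrite /kernel asboolT// subrr mul0r. Qed.

Lemma lattice_isolated c : exists2 d : R, 0 < d &
  forall z, nrm (z - c) < d -> L z -> L c /\ z = c.
Proof.
have [d1 d10 h1] := qpow_away_near c; have [d2 d20 h2] := regular_part_near0.
exists (Num.min d1 d2); first by rewrite lt_min d10.
move=> z; rewrite lt_min => /andP[/h1 z1 /h2[_ _ _ z2 _]] /pole_latticeP[n hn].
have hc : rpowc q (n%:R + c) = 1 by apply: contra_notP (z1 n) _; rewrite hn.
split; first by apply/pole_latticeP; exists n.
apply/eqP; rewrite -subr_eq0; apply/eqP/z2.
have e : n%:R + z = (n%:R + c) + (z - c) by ring.
by move: hn; rewrite e rpowcD hc mul1r.
Qed.

(** The bounds on the kernels are uniform in n: this is what makes the series of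
   kernels converge normally near c, also when c is a pole. *)
Lemma kernel_near c : exists2 d : R, 0 < d & forall z, nrm (z - c) < d ->
  (exists rho M, 0 < rho /\ forall n, jetN rho z (kernel c n) M) /\
  (~ L z -> forall n, kernel c n z != 0 /\
    kernel c n z = (if `[< L c >] then z - c else 1) / (1 - rpowc q (n%:R + z))).
Proof.
have [d1 d10 h1] := qpow_away_near c; have [d2 d20 h2] := regular_part_near0.
exists (Num.min d1 d2); first by rewrite lt_min d10.
move=> z; rewrite lt_min => /andP[/h1 z1 /h2[_ holo_reg _ _ eq_reg]].
have Lnz : ~ L z -> forall n, 1 - rpowc q (n%:R + z) != 0.
  move=> nL n; apply/eqP => /eqP; rewrite subr_eq0 => /eqP/esym h; apply: nL.
  by apply/pole_latticeP; exists n.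
have [rho [M [r0 j]]] := jetN_qpow_inv z.
have [Lc|Lc] := pselect (L c); last first.
  split.
    exists rho, M; split=> // n; have -> : kernel c n = fun w => (1 - rpowc q (n%:R + w))^-1.
      by apply/funext => w; rewrite kernelN.
    by apply: j; apply: z1 => h; apply: Lc; apply/pole_latticeP; exists n.
  by move=> /Lnz nz n; rewrite kernelN// asboolF// div1r invr_eq0.
split; last first.
  move=> nL n; have nz := Lnz nL n; rewrite asboolT//.
  have zc : z - c != 0.
    by rewrite subr_eq0; apply/eqP => zc; apply: nL; rewrite zc.
  suff -> : kernel c n z = (z - c) / (1 - rpowc q (n%:R + z)).
    by split=> //; rewrite mulf_neq0 ?invr_eq0.
  rewrite /kernel asboolT//; case: eqP => // hc.
  have e : rpowc q (n%:R + z) = rpowc q (z - c).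
    have e : n%:R + z = (n%:R + c) + (z - c) by ring.
    by rewrite e rpowcD hc mul1r.
  by rewrite e -{2}eq_reg mulfK// -e.
have h3 : holo z (fun w => regular_part (w - c)).
  apply: (holo_comp (g := fun w => w - c)) => //.
  by apply: holoD; [exact: holo_id|exact: holo_cst].
have [r1 [M1 [r10 j1]]] := holo_jetN h3.
have [r2 [M2 [r20 j2]]] : exists r M, 0 < r /\ jetN r z (fun w => w - c) M.
  by apply: holo_jetN; apply: holoD; [exact: holo_id|exact: holo_cst].
have [m1 m2] := min_shrink r0 r10.
have m0 : 0 < Num.min rho r1 by case/andP: m1.
have [k1 k2] := min_shrink m0 r20.
have s1 : 0 < Num.min (Num.min rho r1) r2 <= rho.
  by case/andP: k1 => -> h; case/andP: m1 => _; exact: le_trans.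
have s2 : 0 < Num.min (Num.min rho r1) r2 <= r1.
  by case/andP: k1 => -> h; case/andP: m2 => _; exact: le_trans.
exists (Num.min (Num.min rho r1) r2), (Num.max M1 (M2 * M)); split; first by case/andP: k1.
move=> n; have [hc|hc] := eqVneq (rpowc q (n%:R + c)) 1.
  have -> : kernel c n = fun w => regular_part (w - c).
    by apply/funext => w; rewrite /kernel asboolT// hc eqxx.
  by apply: jetN_le (jetN_shrink s2 j1); rewrite le_max lexx.
have -> : kernel c n = fun w => (w - c) * (1 - rpowc q (n%:R + w))^-1.
  by apply/funext => w; rewrite /kernel asboolT// (negbTE hc).
apply: (jetN_le (M := M2 * M)); first by rewrite le_max lexx orbT.
apply: jetNM; first exact: jetN_shrink k2 j2.
by apply: jetN_shrink s1 _; apply: j; apply: z1; apply/eqP.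
Qed.

Lemma lattice_index_unique c n n' :
  rpowc q (n%:R + c) = 1 -> rpowc q (n'%:R + c) = 1 -> n = n'.
Proof.
have [q0 q1] := andP q01.
rewrite !rpowcD => h h'.
have /(mulIf (rpowc_neq0 c)) : rpowc q n%:R * rpowc q c = rpowc q n'%:R * rpowc q c.
  by rewrite h h'.
rewrite !rpowc_nat => /(congr1 (@complex.Re R)) /= e.
by apply: (ieexprIn q0 _ e); rewrite lt_eqF.
Qed.

End Lattice.

(** * The binomial series with a complex exponent *)

Section RisingFactorial.

(** The binomial coefficient (z + r - 1 choose r), written with a rising
   factorial: its absolute value is bounded by its value at |z|. *)
Definition ris (F : fieldType) (z : F) (r : nat) : F :=
  (\prod_(i < r) (z + i%:R)) / r`!%:R.

Lemma ris0 (F : fieldType) (z : F) : ris z 0 = 1.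
Proof. by rewrite /ris big_ord0 fact0 divr1. Qed.

Lemma risS (F : numFieldType) (z : F) r : r.+1%:R * ris z r.+1 = (z + r%:R) * ris z r.
Proof.
rewrite /ris big_ord_recr/= factS natrM.
have h2 : r`!%:R != 0 :> F by rewrite pnatr_eq0 -lt0n fact_gt0.
by field; rewrite h2 addrC natr1 pnatr_eq0.
Qed.

Lemma ris_at0 (F : fieldType) r : ris (0 : F) r.+1 = 0.
Proof. by rewrite /ris big_ord_recl addr0 !mul0r. Qed.

Lemma ris_at1 (F : numFieldType) r : ris (1 : F) r = 1.
Proof.
elim: r => [|r ih]; first exact: ris0.
have h1 : r.+1%:R != 0 :> F by rewrite pnatr_eq0.
by apply: (mulfI h1); rewrite risS ih -natr1 addrC.
Qed.

Lemma ris_pascal (F : numFieldType) (z : F) r :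
  ris (z + 1) r.+1 = ris (z + 1) r + ris z r.+1.
Proof.
have h1 : r.+1%:R != 0 :> F by rewrite pnatr_eq0.
have e : z * ris (z + 1) r = r.+1%:R * ris z r.+1.
  elim: r {h1} => [|r ih]; first by rewrite risS !ris0; ring.
  have h1 : r.+1%:R != 0 :> F by rewrite pnatr_eq0.
  rewrite (risS z r.+1); apply: (mulfI h1); rewrite mulrCA risS.
  transitivity ((z + 1 + r%:R) * (z * ris (z + 1) r)); first by ring.
  by rewrite ih -natr1; ring.
apply: (mulfI h1); rewrite risS mulrDr -e -natr1; ring.
Qed.

Variable R : realType.
Local Notation C := R[i].

Lemma cbinomE (z : C) r : cbinom (z + r%:R - 1) r = ris z r.
Proof.
rewrite /cbinom /ris; congr (_ / _).
rewrite (reindex_inj rev_ord_inj)/=; apply: eq_bigr => i _.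
by rewrite natrB// -natr1; ring.
Qed.

Lemma ris_ge0 (x : R) r : 0 <= x -> 0 <= ris x r.
Proof.
move=> x0; rewrite divr_ge0 ?ler0n//; apply: prodr_ge0 => i _.
by rewrite addr_ge0.
Qed.

Lemma ris_le (x y : R) r : 0 <= x -> x <= y -> ris x r <= ris y r.
Proof.
move=> x0 xy; rewrite ler_wpM2r ?invr_ge0 ?ler0n//.
by apply: ler_prod => i _; rewrite addr_ge0//= lerD2r.
Qed.

Lemma nrm_ris (z : C) r : nrm (ris z r) <= ris (nrm z) r.
Proof.
rewrite /ris nrmM nrmV nrm_nat ler_wpM2r ?invr_ge0 ?ler0n// nrm_prod.
apply: ler_prod => i _; rewrite nrm_ge0/=.
by rewrite (le_trans (nrmD _ _))// nrm_nat.
Qed.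

(** Pascal's rule says that multiplication by 1 - y lowers N by one. *)
Lemma sum_ris_nat_le (N : nat) (y : R) : 0 <= y < 1 -> forall n,
  \sum_(r < n) ris (N%:R : R) r * y ^+ r <= (1 - y)^-1 ^+ N.
Proof.
move=> /andP[y0 y1]; have y1' : 0 < 1 - y by rewrite subr_gt0.
have iy1 : 1 <= (1 - y)^-1 by rewrite invf_ge1//; lra.
elim: N => [|N ih] n.
  rewrite expr0; case: n => [|n]; first by rewrite big_ord0.
  rewrite big_ord_recl ris0 mul1r expr0 big1 ?addr0// => i _.
  by rewrite ris_at0 mul0r.
rewrite exprSr ler_pdivlMr//.
case: n => [|n]; first by rewrite big_ord0 mul0r exprn_ge0// invr_ge0 ltW.
apply: le_trans (ih n.+1).
set S := \sum_(r < n.+1) ris N.+1%:R r * _.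
have -> : \sum_(r < n.+1) ris N%:R r * y ^+ r = S - y * \sum_(r < n) ris N.+1%:R r * y ^+ r.
  rewrite /S !big_ord_recl/= !ris0 mulr_sumr -addrA -sumrB; congr (_ + _).
  apply: eq_bigr => i _; rewrite /bump/= add1n -natr1 ris_pascal exprS; ring.
rewrite mulrBr mulr1 lerD2l lerN2 mulrC ler_wpM2r// /S big_ord_recr/= lerDl.
by rewrite mulr_ge0 ?exprn_ge0// ris_ge0.
Qed.

Lemma bsum_ris (s y : R) : 0 <= s -> 0 <= y < 1 ->
  exists M, bsum (fun r => ris s r * y ^+ r) M.
Proof.
move=> s0 /andP[y0 y1]; pose N := (Num.truncn s).+1.
have sN : s <= N%:R by apply/ltW/truncnS_gt.
exists ((1 - y)^-1 ^+ N); apply: bsum_nat => [r|n].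
  by rewrite mulr_ge0 ?ris_ge0 ?exprn_ge0.
have := @sum_ris_nat_le N y; rewrite y0 y1 => /(_ isT n); apply: le_trans.
by apply: ler_sum => r _; rewrite ler_wpM2r ?exprn_ge0// ris_le.
Qed.

End RisingFactorial.

Section BinomialSeries.
Variable R : realType.
Local Notation C := R[i].

Definition pow_deriv (r : nat) (x : C) : C := r%:R * x ^+ r.-1.

Lemma jet_pow (r : nat) (x : C) (rho : R) : 0 < rho ->
  jet rho x (fun y => y ^+ r) (fun h => pow_deriv r x * h)
    ((nrm x + rho) ^+ r - nrm x ^+ r).
Proof.
move=> r0; have jid : jet rho x (fun y : C => y) (fun h => h) rho.
  by rewrite -[X in jet _ _ _ _ X]mul1r; apply: jet_affine => // h; rewrite mul1r.
elim: r => [|r ih].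
  have := jet_cst x 1 r0; rewrite !expr0 subrr.
  by congr jet; apply/funext => h; rewrite /pow_deriv ?mul0r ?expr0.
have := jetM ih jid; set w := (X in jet _ _ _ _ X); set w' := (X in _ -> jet _ _ _ _ X).
have -> : w = w' by rewrite /w /w' nrmX !exprSr; ring.
congr jet; apply/funext => h; first by rewrite exprSr.
by rewrite /pow_deriv; case: r {ih w w'} => [|r]; rewrite ?expr0 /= ?exprS -?natr1; ring.
Qed.

Definition binomial_series (s x : C) : C := sum (fun r => ris s r * x ^+ r).

(** The recurrence (r + 1) b_(r+1) = (s + r) b_r between the coefficients is a
   differential equation for their generating series. *)
Lemma binomial_series_ode (s x : C) : nrm x < 1 -> exists E,
  has_linear_part x (binomial_series s) (fun h => E * h) /\ (1 - x) * E = s * binomial_series s x.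
Proof.
move=> x1; pose rho := (1 - nrm x) / 2.
have r0 : 0 < rho by rewrite divr_gt0// subr_gt0.
have y01 : 0 <= nrm x + rho < 1.
  by have := nrm_ge0 x; rewrite /rho; move: x1; lra.
have [M hM] := bsum_ris (nrm_ge0 s) y01.
have jr r := jetM (jet_cst x (ris s r) r0) (jet_pow r x r0).
have [|w] := jet_sum r0 jr (M := M).
  apply: le_bsum hM => r; rewrite nrmM nrmX.
  rewrite mulr0 mul0r !addr0 -mulrDr addrC subrK.
  by rewrite ler_wpM2r ?nrm_ris// exprn_ge0//; case/andP: y01.
set f := (X in jet _ _ X _ _); set L := (X in jet _ _ _ X _) => j jM.
have xr r : nrm x ^+ r <= (nrm x + rho) ^+ r.
  have yn := andP y01; apply: lerXn2r; rewrite ?nnegrE ?nrm_ge0//; first by case: yn.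
  by rewrite lerDl ltW.
pose a r := ris s r * x ^+ r; pose b r := ris s r * pow_deriv r x.
have nb r : nrm (b r) <= rho^-1 * (ris (nrm s) r * (nrm x + rho) ^+ r).
  have := jet_lin_bound (h := rho%:C) (jr r); rewrite nrm_real gtr0_norm// => /(_ (lexx _)).
  rewrite mulr0 mul0r !addr0 mulr0 addr0 mulrA nrmM -/(b r) nrm_real gtr0_norm//.
  move=> h; rewrite [leRHS]mulrC ler_pdivlMr//; apply: (le_trans h).
  by rewrite ler_pM ?nrm_ge0 ?subr_ge0 ?nrm_ris// ?gerBl ?exprn_ge0 ?nrm_ge0.
have hE : hassum b (sum b).
  apply: (bsum_hassum_sum (M := rho^-1 * M)); apply: le_bsum nb _.
  by apply: bsumZ hM; rewrite invr_ge0 ltW.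
have ha : hassum a (sum a).
  apply: (bsum_hassum_sum (M := M)); apply: le_bsum hM => r.
  by rewrite nrmM nrmX ler_pM ?nrm_ge0 ?exprn_ge0 ?nrm_ge0 ?nrm_ris.
exists (sum b); split.
  have -> : (fun h => sum b * h) = L; last by exists rho, w.
  apply/funext => h; rewrite /L; apply/esym/hassum_sum; rewrite mulrC.
  by apply: eq_hassum (hassumZ h hE) => r; rewrite /b mulr0 addr0; ring.
have h1 := hassum_shift hE; have h2 := hassumD (hassumZ s ha) (hassumZ x hE).
have e : sum b - b 0%N = s * sum a + x * sum b.
  apply: hassum_unique h1 _; apply: eq_hassum h2 => r.
  have -> : b r.+1 = (r.+1%:R * ris s r.+1) * x ^+ r by rewrite /b /pow_deriv/=; ring.
  rewrite risS /a /b /pow_deriv; case: r => [|r]; first by rewrite !mul0r; ring.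
  by rewrite /= exprS; ring.
have b00 : b 0%N = 0 by rewrite /b /pow_deriv mul0r mulr0.
by rewrite mulrBl mul1r; move: e; rewrite b00 subr0 => {1}->; rewrite addrK.
Qed.

Lemma binomial_series0 (s : C) : binomial_series s 0 = 1.
Proof.
have := @hassum1 R _ (fun r => ris s r * 0 ^+ r) 0%N.
rewrite ris0 expr0 mulr1 => h; apply: hassum_sum; apply: h => -[|i]// _.
by rewrite expr0n mulr0.
Qed.

Lemma hassum_binomial_series (s x : C) : nrm x < 1 ->
  hassum (fun r => ris s r * x ^+ r) (binomial_series s x).
Proof.
move=> x1; have y01 : 0 <= nrm x < 1 by rewrite nrm_ge0.
have [M hM] := bsum_ris (nrm_ge0 s) y01.
apply: (bsum_hassum_sum (M := M)); apply: le_bsum hM => r.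
by rewrite nrmM nrmX ler_wpM2r ?nrm_ris// exprn_ge0// nrm_ge0.
Qed.

Lemma is_derive_quadratic (f : R -> R) (x c r : R) : 0 < r ->
  (forall h, `|h| <= r -> `|f (x + h) - f x| <= c * h ^+ 2) -> is_derive x (1 : R) f 0.
Proof.
move=> r0 hf; have c0 : 0 <= c.
  have := hf r; rewrite gtr0_norm// => /(_ (lexx _)) /(le_trans (normr_ge0 _)).
  by rewrite pmulr_lge0// exprn_gt0.
have cv : (fun h : R => h^-1 *: ((f \o shift x) (h *: (1 : R)) - f x)) @ 0^' --> (0 : R).
  apply/cvgrPdist_lt => e e0; near=> h.
  have h0 : h != 0 by near: h; exact: nbhs_dnbhs_neq.
  have hn : 0 < `|h| by rewrite normr_gt0.
  have hs : `|h| < Num.min r (e / (c + 1)).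
    by near: h; apply: dnbhs0_lt; rewrite lt_min r0 divr_gt0// ltr_wpDl.
  move: hs; rewrite lt_min => /andP[h1 h2].
  rewrite sub0r normrN /= normrZ normfV mulrC ltr_pdivrMr//.
  have -> : h *: 1 + x = x + h by rewrite addrC -[h *: 1]/(h * 1) mulr1.
  rewrite (le_lt_trans (hf h (ltW h1)))// -real_normK ?num_real// expr2 mulrA ltr_pM2r//.
  by move: h2; rewrite ltr_pdivlMr ?ltr_wpDl//; lra.
split; first by apply/cvg_ex; exists 0.
exact: cvg_lim cv.
Unshelve. all: by end_near. Qed.

Lemma linear_part0_const (f : C -> C) (T : R) : 0 <= T ->
  (forall t : R, 0 <= t <= T -> has_linear_part (t%:C : C) f (fun=> 0)) -> f T%:C = f 0%:C.
Proof.
move=> T0 hf.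
have key (p : C -> R) : (forall z, `|p z| <= nrm z) -> (forall z w, p (z - w) = p z - p w) ->
    p (f T%:C) = p (f 0%:C).
  move=> pn pB; pose g (t : R) := p (f t%:C).
  have dg (t : R) : 0 <= t <= T -> is_derive t (1 : R) g 0.
    move=> /hf[rho [w [r0 _ [b [c [_ c0 _ _ fc]]]]]].
    apply: (is_derive_quadratic (c := c) r0) => h hr.
    rewrite /g -pB (le_trans (pn _))//.
    have := fc h%:C; rewrite nrm_real => /(_ hr).
    by rewrite subr0 -rmorphD/= real_normK// num_real.
  have [||x _] := @MVT_segment R g (fun=> 0) 0 T T0.
  - by move=> x; rewrite in_itv/= => /andP[h1 h2]; apply: dg; rewrite !ltW.
  - apply: continuous_in_subspaceT => x; rewrite inE/= in_itv/= => /dg h.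
    by apply: differentiable_continuous; apply/derivable1_diffP; case: h.
  by rewrite mul0r => /eqP; rewrite subr_eq0 => /eqP.
apply/eqP; rewrite eq_complex; apply/andP; split; apply/eqP; apply: key.
- exact: nrm_Re.
- by case=> a b [].
- exact: nrm_Im.
- by case=> a b [].
Qed.

(** The binomial series solves (1 - x) y' = s y, hence its product with
   (1 - x)^s is constant along the path x = 1 - exp(-t). *)
Lemma binomial_seriesE (s : C) (x : R) : 0 <= x < 1 ->
  binomial_series s x%:C = rpowc (1 - x) (- s).
Proof.
move=> /andP[x0 x1]; pose g (z : C) := 1 - cexp (- z).
pose f z := binomial_series s (g z) * cexp (- s * z).
have y0 : 0 < 1 - x by rewrite subr_gt0.
pose T := - ln (1 - x); have T0 : 0 <= T by rewrite oppr_ge0 ln_le0//; lra.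
have hg z : has_linear_part z g (fun h => cexp (- z) * h).
  have h1 : has_linear_part z (fun z => - z : C) (fun h => - h).
    apply: (@linear_part_affine _ _ _ _ _ 1) => // [a u v|h|h].
    - by rewrite -[a *: u]/(a * u); ring.
    - by rewrite nrmN mul1r.
    - by rewrite opprD.
  have h2 := linear_partM (linear_part_cst z (-1)) (linear_part_comp h1 (linear_part_cexp _)).
  have := linear_partD (linear_part_cst z 1) h2.
  congr has_linear_part; apply/funext => h; rewrite ?/g; ring.
have hs z : has_linear_part z (fun z => cexp (- s * z)) (fun h => cexp (- s * z) * (- s * h)).
  apply: linear_part_comp (linear_part_cexp _).
  apply: (@linear_part_affine _ _ _ _ _ (nrm s)) => [|a u v|h|h]; first exact: nrm_ge0.
  - by rewrite -[a *: u]/(a * u); ring.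
  - by rewrite nrmM nrmN.
  - by rewrite mulrDr.
have gE (t : R) : g t%:C = (1 - expR (- t))%:C by rewrite /g -rmorphN/= cexp_real rmorphB.
have fc : f T%:C = f 0%:C.
  apply: linear_part0_const => // t /andP[t0 tT].
  have g1 : nrm (g t%:C) < 1.
    rewrite gE nrm_real ger0_norm; first by rewrite gtrBl expR_gt0.
    by rewrite subr_ge0 -[leRHS]expR0 ler_expR oppr_le0.
  have [E [hE ode]] := binomial_series_ode s g1.
  have := linear_partM (linear_part_comp (hg t%:C) hE) (hs t%:C).
  congr has_linear_part; apply/funext => h.
  have -> : cexp (- t%:C) = 1 - g t%:C by rewrite /g; ring.
  transitivity (cexp (- s * t%:C) * h * ((1 - g t%:C) * E - s * binomial_series s (g t%:C))).
    by ring.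
  by rewrite ode subrr mulr0.
move: fc; rewrite /f !gE oppr0 expR0 subrr binomial_series0 mulr0 cexp0 mulr1.
rewrite /T opprK lnK ?posrE// opprB addrC subrK => h.
rewrite rpowcE; have := congr1 (fun z => z * cexp (s * T%:C)) h.
rewrite mul1r -mulrA -cexpD mulNr addNr cexp0 mulr1 => ->; congr cexp.
by rewrite /T rmorphN; ring.
Qed.

End BinomialSeries.

(** * Normal convergence of the expansion *)

Section Expansion.
Variables (R : realType) (q : R) (d : nat).
Hypothesis q01 : 0 < q < 1.
Local Notation C := R[i].
Local Notation V := ('rV[C]_d * 'rV[C]_d)%type.
Implicit Types (s t : 'rV[C]_d) (r a : d.-tuple nat).

Lemma exists_common (n : nat) (P : 'I_n -> R -> Prop) :
  (forall (j : 'I_n) (e e' : R), 0 < e' <= e -> P j e -> P j e') ->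
  (forall j, exists2 e, 0 < e & P j e) -> exists2 e, 0 < e & forall j, P j e.
Proof.
move=> mono; elim: n P mono => [|n ih] P mono h; first by exists 1 => // -[].
have [e1 e10 h1] := h ord0.
have [|j|e2 e20 h2] := ih (fun j => P (lift ord0 j)).
- by move=> j; apply: mono.
- exact: h.
have [m1 m2] := min_shrink e10 e20.
exists (Num.min e1 e2); first by case/andP: m1.
move=> j; case: (unliftP ord0 j) => [j' ->|->]; first exact: mono m2 (h2 j').
exact: mono m1 h1.
Qed.

Definition tailn (j : 'I_d) r : nat := \sum_(i < d | (j <= i)%N) tnth r i.

(** The general term of the expansion, with the factor that depends on t left
   free: it depends on r through the partial sum r_j + ... + r_d only. *)
Definition gterm (B : 'I_d -> nat -> C) s r : C :=
  \prod_(j < d) (ris (s 0 j) (tnth r j) * (q ^+ (j.+1 * tnth r j))%:C * B j (tailn j r)).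

Lemma tail_natD r t (j : 'I_d) :
  \sum_(i < d | (j <= i)%N) ((tnth r i)%:R + t 0 i) = (tailn j r)%:R + tail j t.
Proof. by rewrite big_split/= -natr_sum. Qed.

Lemma expansion_termE s t r : expansion_term q s t r =
  gterm (fun j n => rpowc q (j.+1%:R * t 0 j) * (1 - rpowc q (n%:R + tail j t))^-1) s r.
Proof.
apply: eq_bigr => j _; rewrite cbinomE tail_natD mulrDr rpowcD -natrM rpowc_nat//.
by rewrite !mulrA.
Qed.

Lemma qpow_le (n m : nat) : (n <= m)%N -> q ^+ m <= q ^+ n.
Proof.
have [q0 q1] := andP q01 => nm; rewrite ler_wiXn2l// ltW//.
Qed.

Lemma qpow_ge0 n : 0 <= q ^+ n.
Proof. by have [q0 _] := andP q01; rewrite exprn_ge0// ltW. Qed.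

(** Bounding the factors B by constants decouples the indices: the majorant is a
   product of one-variable terms, hence is summable over all tuples. *)
Definition majorant (M sigma : 'I_d -> R) r : R :=
  \prod_(j < d) (M j * (ris (sigma j) (tnth r j) * q ^+ tnth r j)).

Lemma bsum_majorant (M sigma : 'I_d -> R) : (forall j, 0 <= M j) ->
  (forall j, 0 <= sigma j) -> exists N, bsum (majorant M sigma) N.
Proof.
move=> M0 s0; have q01' : 0 <= q < 1 by have [q0 ->] := andP q01; rewrite ltW.
have /choice[K hK] : forall j, exists K, bsum (fun n => ris (sigma j) n * q ^+ n) K.
  by move=> j; apply: bsum_ris.
exists (\prod_(j < d) (M j * K j)).
apply: (bsum_tuple (m := fun j n => M j * (ris (sigma j) n * q ^+ n))) => [j n|j].
  by rewrite mulr_ge0// mulr_ge0 ?qpow_ge0//; apply: ris_ge0.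
exact: bsumZ (M0 j) (hK j).
Qed.

Lemma nrm_gterm_le (B : 'I_d -> nat -> C) (M : 'I_d -> R) s r :
  (forall j n, nrm (B j n) <= M j) ->
  nrm (gterm B s r) <= majorant M (fun j => nrm (s 0 j)) r.
Proof.
move=> BM; rewrite nrm_prod; apply: ler_prod => j _; rewrite nrm_ge0/=.
rewrite nrmM nrmM nrm_real ger0_norm ?qpow_ge0// mulrC.
have M0 : 0 <= M j by apply: le_trans (nrm_ge0 _) (BM j 0%N).
apply: ler_pM => //; rewrite ?nrm_ge0 ?mulr_ge0 ?qpow_ge0 ?nrm_ge0//.
by rewrite ler_pM ?nrm_ge0 ?qpow_ge0 ?nrm_ris// qpow_le// leq_pmull.
Qed.

Lemma bsum_gterm (B : 'I_d -> nat -> C) (M : 'I_d -> R) s :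
  (forall j n, nrm (B j n) <= M j) -> exists N, bsum (fun r => nrm (gterm B s r)) N.
Proof.
move=> BM; have M0 j : 0 <= M j by apply: le_trans (nrm_ge0 _) (BM j 0%N).
have [N hN] := bsum_majorant M0 (fun j => nrm_ge0 (s 0 j)).
by exists N; apply: le_bsum hN => r; apply: nrm_gterm_le.
Qed.

Lemma nrm_entry s (j : 'I_d) : nrm (s 0 j) <= nrm s.
Proof.
rewrite -lecR !nrmE [leRHS]mx_normE.
exact: (le_bigmax _ (fun i : 'I_1 * 'I_d => (widen_itv `|s i.1 i.2|%:itv : {nonneg C})) (0, j)).
Qed.

Lemma nrm_fst (p : V) : nrm p.1 <= nrm p.
Proof.
rewrite -lecR !nrmE [leRHS]prod_normE -!nrmE comparable_le_max ?lexx//.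
by rewrite /Order.comparable !lecR le_total.
Qed.

Lemma nrm_snd (p : V) : nrm p.2 <= nrm p.
Proof.
rewrite -lecR !nrmE [leRHS]prod_normE -!nrmE comparable_le_max ?lexx ?orbT//.
by rewrite /Order.comparable !lecR le_total.
Qed.

Lemma jetN_ris (rho : R) (x : V) (j : 'I_d) n : 0 < rho ->
  jetN rho x (fun y => ris (y.1 0 j) n) (ris (nrm (x.1 0 j) + rho) n).
Proof.
move=> r0; rewrite /ris.
have := jetNM (jetN_prod r0 (d := n) (f := fun i (y : V) => y.1 0 j + i%:R)
  (M := fun i => nrm (x.1 0 j) + rho + i%:R) (fun i => _)) (jetN_cst x (n`!%:R^-1) r0).
rewrite nrmV nrm_nat; apply.
move=> i; exists (fun h : V => h.1 0 j), (1 * rho); split; last first.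
  rewrite mul1r addrAC lerD2r (le_trans (nrmD _ _))// nrm_nat//.
apply: jet_affine => // [k u v|h|h].
- by rewrite mxE mxE.
- by rewrite mul1r (le_trans (nrm_entry _ _))// nrm_fst.
- by rewrite mxE addrAC.
Qed.

Lemma gterm_sum_holo (B : 'I_d -> nat -> V -> C) (x : V) :
  (forall j, exists rho M, 0 < rho /\ forall n, jetN rho x (B j n) M) ->
  holo x (fun y => sum (gterm (fun j n => B j n y) y.1)).
Proof.
move=> hB.
have [rho r0 hrho] : exists2 rho, 0 < rho & forall j, exists M, forall n, jetN rho x (B j n) M.
  apply: exists_common => [j e e' ee [M hM]|j].
    by exists M => n; apply: jetN_shrink (hM n).
  by have [rho [M [r0 hM]]] := hB j; exists rho => //; exists M.
have {hrho}/choice[M hM] := hrho.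
have M0 j : 0 <= M j by apply: le_trans (nrm_ge0 _) (jetN_bound (hM j 0%N)).
have [N hN] := bsum_majorant M0 (fun j => addr_ge0 (nrm_ge0 (x.1 0 j)) (ltW r0)).
have jr r : jetN rho x (fun y => gterm (fun j n => B j n y) y.1 r)
    (majorant M (fun j => nrm (x.1 0 j) + rho) r).
  apply: jetN_prod => // j.
  apply: (@jetN_le _ _ _ _ _ (ris (nrm (x.1 0 j) + rho) (tnth r j) *
    nrm ((q ^+ (j.+1 * tnth r j))%:C : C) * M j)).
    rewrite [leLHS]mulrC nrm_real ger0_norm ?qpow_ge0//.
    apply: ler_wpM2l => //; apply: ler_wpM2l; last by rewrite qpow_le// leq_pmull.
    by rewrite ris_ge0// addr_ge0 ?nrm_ge0// ltW.
  by apply: jetNM => //; apply: jetNM; [exact: jetN_ris|exact: jetN_cst].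
have [L [w [j _]]] := jetN_sum r0 jr hN.
by exists L, rho, w.
Qed.

End Expansion.

(** * Equality of the two series in the region of convergence *)

Section Gaps.
Variable d : nat.
Implicit Types (a : d.-tuple nat) (k : increasing_index d).

(** k_1 < ... < k_d is encoded by the d-tuple of the gaps k_j - k_(j-1) - 1. *)
Definition partial_gap a n : nat := \sum_(m < n) (nth 0%N a m).+1.

Lemma partial_gapS a n : partial_gap a n.+1 = (partial_gap a n + (nth 0%N a n).+1)%N.
Proof. by rewrite /partial_gap big_ord_recr. Qed.

Definition of_gaps a : d.-tuple nat := [tuple partial_gap a j.+1 | j < d].

Lemma nth_of_gaps a n : (n <= d)%N -> nth 0%N (0%N :: of_gaps a) n = partial_gap a n.
Proof.
case: n => [_|n nd]; first by rewrite /partial_gap big_ord0.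
by rewrite /= (nth_map (Ordinal nd)) ?size_enum_ord// nth_enum_ord.
Qed.

Lemma path_of_gaps a : path ltn 0%N (of_gaps a).
Proof.
apply/(pathP 0%N) => n; rewrite size_tuple => nd.
rewrite -[nth 0%N (of_gaps a) n]/(nth 0%N (0%N :: of_gaps a) n.+1).
by rewrite !nth_of_gaps ?(ltnW nd)// partial_gapS addnS /= ltnS leq_addr.
Qed.

Definition index_of_gaps a : increasing_index d := exist _ (of_gaps a) (path_of_gaps a).

Definition gaps_of_index k : d.-tuple nat :=
  [tuple (nth 0%N (0%N :: val k) j.+1 - nth 0%N (0%N :: val k) j).-1 | j < d].

Lemma tnth_of_gaps a (j : 'I_d) : tnth (of_gaps a) j = partial_gap a j.+1.
Proof. by rewrite tnth_mktuple. Qed.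

Lemma of_gapsK : cancel index_of_gaps gaps_of_index.
Proof.
move=> a; apply: eq_from_tnth => j; rewrite tnth_mktuple.
rewrite [val _]/(of_gaps a) !nth_of_gaps ?(ltnW (ltn_ord j))// partial_gapS addKn/=.
by rewrite (tnth_nth 0%N).
Qed.

Lemma gaps_ofK : cancel gaps_of_index index_of_gaps.
Proof.
move=> [k pk]; apply/val_inj; apply: eq_from_tnth => j.
rewrite [LHS]tnth_of_gaps [RHS](tnth_nth 0%N).
rewrite -[RHS]/(nth 0%N (0%N :: k) j.+1).
move: (ltn_ord j); elim: (nat_of_ord j).+1 => [_|n ih nd]; first by rewrite /partial_gap big_ord0.
rewrite partial_gapS ih ?(ltnW nd)//.
have -> : nth 0%N (gaps_of_index (exist _ k pk)) n =
    (nth 0%N (0%N :: k) n.+1 - nth 0%N (0%N :: k) n).-1.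
  by rewrite -(tnth_nth 0%N _ (Ordinal nd)) tnth_mktuple.
have /(pathP 0%N)/(_ n) := pk; rewrite size_tuple => /(_ nd) /= h.
by rewrite prednK ?subn_gt0// subnKC// ltnW.
Qed.

Lemma partial_gap_tnth a (j : 'I_d) :
  partial_gap a j.+1 = \sum_(i < d | (i <= j)%N) (tnth a i).+1.
Proof.
rewrite /partial_gap (big_ord_widen d (fun m => (nth 0%N a m).+1))//.
by apply: eq_big => i; rewrite ?ltnS// (tnth_nth 0%N).
Qed.

End Gaps.

Section Identity.
Variables (R : realType) (q : R) (d : nat).
Hypothesis q01 : 0 < q < 1.
Local Notation C := R[i].
Implicit Types (s t z : 'rV[C]_d) (r a : d.-tuple nat).

(** Abel summation: sum_j k_j z_j in terms of the gaps and of the tails. *)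
Lemma sum_gaps_tail a (z : 'I_d -> C) :
  \sum_(j < d) (partial_gap a j.+1)%:R * z j =
  \sum_(i < d) (tnth a i).+1%:R * \sum_(j < d | (i <= j)%N) z j.
Proof.
under eq_bigr do rewrite partial_gap_tnth natr_sum mulr_suml.
rewrite (exchange_big_dep xpredT)//=; apply: eq_bigr => i _.
by rewrite mulr_sumr.
Qed.

Lemma qtail_lt1 t (n : nat) (i : 'I_d) : conv_region t -> nrm (rpowc q (n%:R + tail i t)) < 1.
Proof.
move=> /(_ i) ti; rewrite (nrm_rpowc q) -expR0 ltr_expR nmulr_rlt0 ?lnq_lt0//.
rewrite raddfD/= ltr_wpDl//.
by rewrite -(rmorph_nat (real_complex R)) /= ler0n.
Qed.

Variables (s t : 'rV[C]_d).
Hypothesis tC : conv_region t.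

(** The double family: sum over r first by the binomial series, over the gaps
   first by geometric series. *)
Definition double_term (p : d.-tuple nat * d.-tuple nat) : C :=
  \prod_(j < d) (ris (s 0 j) (tnth p.2 j) *
    rpowc q ((partial_gap p.1 j.+1)%:R * ((tnth p.2 j)%:R + t 0 j))).

Definition inner_r a : C :=
  \prod_(j < d) (rpowc q ((partial_gap a j.+1)%:R * t 0 j) *
    rpowc (1 - q ^+ partial_gap a j.+1) (- s 0 j)).

Lemma qgap_lt1 a (j : 'I_d) : 0 <= q ^+ partial_gap a j.+1 < 1.
Proof.
rewrite (qpow_ge0 q01) partial_gapS addnS/= exprn_ilt1//; case/andP: q01 => // q0 _.
exact: ltW.
Qed.

Lemma hassum_double_r a : hassum (fun r => double_term (a, r)) (inner_r a).
Proof.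
have y1 (j : 'I_d) : nrm ((q ^+ partial_gap a j.+1)%:C : C) < 1.
  by rewrite nrm_real ger0_norm ?(qpow_ge0 q01)//; case/andP: (qgap_lt1 a j).
have /choice[K hK] : forall j : 'I_d, exists K : R, bsum (fun n => ris (nrm (s 0 j)) n *
    nrm ((q ^+ partial_gap a j.+1)%:C : C) ^+ n) K.
  by move=> j; apply: bsum_ris; rewrite ?nrm_ge0 ?y1.
have := hassum_tuple (a := fun j n => rpowc q ((partial_gap a j.+1)%:R * t 0 j) *
   (ris (s 0 j) n * (q ^+ partial_gap a j.+1)%:C ^+ n))
   (M := fun j => nrm (rpowc q ((partial_gap a j.+1)%:R * t 0 j)) * K j)
   (S := fun j => rpowc q ((partial_gap a j.+1)%:R * t 0 j) *
     rpowc (1 - q ^+ partial_gap a j.+1) (- s 0 j)) => h.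
apply: eq_hassum (h _ _) => [r|j|j] /=.
- apply: eq_bigr => j _; rewrite mulrDr rpowcD -natrM rpowc_nat//.
  by rewrite exprM -rmorphXn/=; ring.
- apply: le_bsum (bsumZ (nrm_ge0 _) (hK j)) => n.
  rewrite nrmM (nrmM (ris (s 0 j) n)) nrmX ler_wpM2l ?nrm_ge0//.
  by rewrite ler_wpM2r ?exprn_ge0 ?nrm_ge0 ?nrm_ris.
- apply: hassumZ; rewrite -binomial_seriesE ?qgap_lt1//.
  exact: hassum_binomial_series (y1 j).
Qed.

Lemma hassum_double_gaps r : hassum (fun a => double_term (a, r)) (expansion_term q s t r).
Proof.
pose T (i : 'I_d) := (tailn i r)%:R + tail i t.
have T1 i : nrm (rpowc q (T i)) < 1 by apply: qtail_lt1.
have y01 i : 0 <= nrm (rpowc q (T i)) < 1 by rewrite nrm_ge0 T1.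
have hT : hassum (fun a : d.-tuple nat => \prod_(i < d) (rpowc q (T i) * rpowc q (T i) ^+ tnth a i))
    (\prod_(i < d) (rpowc q (T i) / (1 - rpowc q (T i)))).
  apply: (hassum_tuple (a := fun i n => rpowc q (T i) * rpowc q (T i) ^+ n)
    (M := fun i => nrm (rpowc q (T i)) * (1 - nrm (rpowc q (T i)))^-1)) => i.
    apply: le_bsum (bsumZ (nrm_ge0 _) (bsum_geometric (y01 i))) => n.
    by rewrite nrmM nrmX.
  exact: hassumZ (hassum_geometric (T1 i)).
have prodT : \prod_(i < d) rpowc q (T i) =
    \prod_(j < d) rpowc q (j.+1%:R * ((tnth r j)%:R + t 0 j)).
  rewrite -!rpowc_sum; congr rpowc.
  under eq_bigr do rewrite /T -tail_natD.
  rewrite (exchange_big_dep xpredT)//=; apply: eq_bigr => j _.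
  rewrite mulr_natl; set z := _ + _.
  rewrite -[j.+1 in RHS]card_ord -sumr_const.
  by rewrite (big_ord_widen d (fun=> z))//; apply: eq_bigl => i; rewrite ltnS.
have -> : expansion_term q s t r = (\prod_(j < d) ris (s 0 j) (tnth r j)) *
    \prod_(i < d) (rpowc q (T i) / (1 - rpowc q (T i))).
  rewrite (big_split _ _ _ (fun i => rpowc q (T i))) prodT -big_split/= -big_split/=.
  by apply: eq_bigr => j _; rewrite cbinomE tail_natD mulrA.
apply: eq_hassum (hassumZ _ hT) => a.
rewrite /double_term /= (big_split _ _ _ (fun j => ris (s 0 j) (tnth r j)))/=.
congr (_ * _).
rewrite -rpowc_sum sum_gaps_tail rpowc_sum; apply: eq_bigr => i _.
by rewrite -exprS rpowcMn tail_natD.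
Qed.

Lemma bsum_double : exists M, bsum (fun p => nrm (double_term p)) M.
Proof.
pose y (i : 'I_d) := nrm (rpowc q (tail i t)).
have y01 i : 0 <= y i < 1.
  by rewrite /y nrm_ge0 -[tail i t]add0r; apply: (qtail_lt1 0).
have [K hK] := bsum_majorant q01 (fun _ : 'I_d => ler01) (fun j => nrm_ge0 (s 0 j)).
have hG : bsum (fun a : d.-tuple nat => \prod_(i < d) (y i * y i ^+ tnth a i))
    (\prod_(i < d) (y i * (1 - y i)^-1)).
  apply: (bsum_tuple (m := fun i n => y i * y i ^+ n)) => [i n|i].
    by rewrite mulr_ge0 ?exprn_ge0//; case/andP: (y01 i).
  by apply: bsumZ (bsum_geometric _); case/andP: (y01 i).
have y0 i : 0 <= y i by case/andP: (y01 i).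
have G0 (a : d.-tuple nat) : 0 <= \prod_(i < d) (y i * y i ^+ tnth a i).
  by apply: prodr_ge0 => i _; rewrite mulr_ge0// exprn_ge0.
have m0 r : 0 <= majorant q (fun=> 1) (fun j => nrm (s 0 j)) r.
  by apply: prodr_ge0 => j _; rewrite mul1r mulr_ge0 ?(qpow_ge0 q01)//; apply/ris_ge0/nrm_ge0.
exists (\prod_(i < d) (y i * (1 - y i)^-1) * K); apply: le_bsum (bsum_prod G0 m0 hG hK) => -[a r].
have -> : double_term (a, r) = \prod_(j < d) (ris (s 0 j) (tnth r j) *
    (q ^+ (partial_gap a j.+1 * tnth r j))%:C) * \prod_(i < d) rpowc q (tail i t) ^+ (tnth a i).+1.
  transitivity (\prod_(j < d) (ris (s 0 j) (tnth r j) *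
    (q ^+ (partial_gap a j.+1 * tnth r j))%:C) *
    \prod_(j < d) rpowc q ((partial_gap a j.+1)%:R * t 0 j)).
    rewrite -big_split/=; apply: eq_bigr => j _.
    by rewrite /= mulrDr rpowcD -natrM rpowc_nat// mulrA.
  congr (_ * _); rewrite -rpowc_sum sum_gaps_tail rpowc_sum.
  by apply: eq_bigr => i _; rewrite rpowcMn.
rewrite nrmM mulrC !nrm_prod; apply: ler_pM; rewrite ?prodr_ge0//.
- by move=> i _; apply: nrm_ge0.
- by move=> i _; apply: nrm_ge0.
- by apply: ler_prod => i _; rewrite nrm_ge0/= nrmX exprS.
apply: ler_prod => j _; rewrite nrm_ge0/= mul1r nrmM nrm_real ger0_norm ?(qpow_ge0 q01)//.
rewrite ler_pM ?nrm_ge0 ?(qpow_ge0 q01) ?nrm_ris// (qpow_le q01)//.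
by rewrite leq_pmull// partial_gapS addnS.
Qed.

Lemma rpowc_div (x y : R) (z : C) : 0 < x -> 0 < y -> rpowc (x / y) z = rpowc x z / rpowc y z.
Proof.
move=> x0 y0; rewrite !rpowcE ln_div ?posrE// rmorphB mulrBl cexpD cexpN//.
Qed.

Lemma fq_termE a : fq_term q s t (index_of_gaps a) =
  rpowc (1 - q) (\sum_(j < d) s 0 j) * inner_r a.
Proof.
have [q0 q1] := andP q01.
have k0 : 0 < 1 - q by rewrite subr_gt0.
have -> : fq_term q s t (index_of_gaps a) =
    rpowc q (\sum_(j < d) (partial_gap a j.+1)%:R * t 0 j) /
    \prod_(j < d) rpowc (qint q (partial_gap a j.+1)) (s 0 j).
  rewrite /fq_term; congr (rpowc q _ / _); apply: eq_bigr => j _.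
    by rewrite tnth_of_gaps.
  by rewrite tnth_of_gaps.
rewrite /inner_r.
rewrite (big_split _ _ _ (fun j : 'I_d => rpowc q ((partial_gap a j.+1)%:R * t 0 j)))/=.
rewrite [in LHS]rpowc_sum [RHS]mulrCA; congr (_ * _).
have -> : rpowc (1 - q) (\sum_(j < d) s 0 j) = \prod_(j < d) rpowc (1 - q) (s 0 j).
  by rewrite rpowcE mulr_sumr cexp_sum; apply: eq_bigr => j _; rewrite rpowcE.
rewrite -prodfV -big_split/=; apply: eq_bigr => j _.
have kk : 0 < 1 - q ^+ partial_gap a j.+1 by rewrite subr_gt0; case/andP: (qgap_lt1 a j).
rewrite /qint rpowc_div// invf_div; congr (_ * _).
by rewrite !rpowcE mulrN cexpN.
Qed.

Lemma fq_identity : (exists M, bsum (fun k => nrm (fq_term q s t k)) M) /\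
  fq q s t = fq_expansion q s t.
Proof.
have [M hM] := bsum_double.
have [gM [S gS hS]] := hassum_fubini_swap hM hassum_double_r hassum_double_gaps.
set c := rpowc (1 - q) (\sum_(j < d) s 0 j).
have e k : fq_term q s t k = c * inner_r (gaps_of_index k).
  by rewrite -{1}[k]gaps_ofK fq_termE.
split.
  exists (nrm c * M).
  apply: le_bsum (bsum_inj (can_inj (@gaps_ofK d)) (bsumZ (nrm_ge0 c) gM)) => k.
  by rewrite e nrmM.
rewrite /fq /fq_expansion -/c (hassum_sum hS); apply: hassum_sum.
apply: eq_hassum (hassumZ c (hassum_bij (@gaps_ofK d) (@of_gapsK d) gS)) => k.
by rewrite e.
Qed.

End Identity.

(** * Identity theorem along complex lines *)

Section EntireOnLines.
Variable R : realType.
Local Notation C := R[i].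

(** If h_0, ..., h_(n-1) vanish, then |h_n| x^n is at most K x^(n+1) for all
   small x > 0. *)
Lemma power_series_eq0 (h : nat -> C) (K delta : R) : 0 < delta ->
  bsum (fun n => nrm (h n)) K ->
  (forall z : C, nrm z < delta -> hassum (fun n => h n * z ^+ n) 0) ->
  forall n, h n = 0.
Proof.
move=> d0 hK hz n; elim/ltn_ind: n => n ih.
apply: eq_of_nrm_small => e e0; rewrite subr0.
have K0 := bsum_ge0 hK.
pose x := Num.min (Num.min (delta / 2) 1) (e / 2 / (K + 1)).
have K1 : 0 < K + 1 by rewrite ltr_wpDl.
have x0 : 0 < x by rewrite !lt_min ltr01 !divr_gt0.
have xd : x < delta.
  by rewrite !gt_min ltr_pdivrMr// ltr_pMr// ltr1n.
have x1 : x <= 1 by rewrite !ge_min lexx orbT.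
have xe : x * K < e.
  apply: (@le_lt_trans _ _ (e / 2 / (K + 1) * K)).
    by rewrite ler_wpM2r// !ge_min lexx orbT.
  rewrite mulrAC ltr_pdivrMr//.
  by have := mulr_ge0 (ltW e0) K0; lra.
have nx : nrm (x%:C : C) = x by rewrite nrm_real gtr0_norm.
have := hz x%:C; rewrite nx => /(_ xd) h0.
pose a i := h i * x%:C ^+ i.
have h1 : hassum (fun i => if i == n then a i else 0) (a n).
  have := @hassum1 _ _ (fun i => if i == n then a i else 0) n.
  by rewrite eqxx; apply => i /negbTE ->.
have hb := hassumB h0 h1.
have := hassum_nrm_le (M := x ^+ n.+1 * K) _ hb.
rewrite sub0r nrmN /a nrmM nrmX nx => le_n.
have : nrm (h n) * x ^+ n <= x ^+ n.+1 * K.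
  apply: le_n; apply: le_bsum (bsumZ (exprn_ge0 n.+1 (ltW x0)) hK) => i.
  have p0 : 0 <= x ^+ n.+1 * nrm (h i) by rewrite mulr_ge0 ?nrm_ge0// exprn_ge0// ltW.
  case: (ltngtP i n) => [i_n|n_i|in_]; last by move: p0; rewrite in_ subrr nrm0.
    by rewrite ih// mul0r subr0 nrm0 mulr0.
  rewrite subr0 nrmM nrmX nx mulrC ler_wpM2r ?nrm_ge0//.
  by apply: ler_wiXn2l => //; exact: ltW.
rewrite exprS mulrAC ler_pM2r ?exprn_gt0// => le_e.
exact: le_lt_trans le_e xe.
Qed.

Implicit Types p : {poly C}.

(** The l^1 norm of the coefficients, which is submultiplicative. *)
Definition poly_norm1 (p : {poly C}) : R := \sum_(i < size p) nrm p`_i.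

Lemma poly_norm1E p n : (size p <= n)%N -> poly_norm1 p = \sum_(i < n) nrm p`_i.
Proof.
move=> pn; rewrite /poly_norm1 (big_ord_widen n (fun i => nrm p`_i))// big_mkcond/=.
apply: eq_bigr => i _; case: ltnP => // /(nth_default 0) ->.
by rewrite nrm0.
Qed.

Lemma poly_norm1_ge0 p : 0 <= poly_norm1 p.
Proof. by apply: sumr_ge0 => i _; apply: nrm_ge0. Qed.

Lemma poly_norm1D p (q : {poly C}) : poly_norm1 (p + q) <= poly_norm1 p + poly_norm1 q.
Proof.
pose n := maxn (size p) (size q).
rewrite (@poly_norm1E (p + q) n) ?size_polyD// (@poly_norm1E p n) ?leq_maxl//.
rewrite (@poly_norm1E q n) ?leq_maxr// -big_split/=.
by apply: ler_sum => i _; rewrite coefD nrmD.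
Qed.

Lemma poly_norm1Z c p : poly_norm1 (c *: p) = nrm c * poly_norm1 p.
Proof.
rewrite (@poly_norm1E (c *: p) (size p)) ?size_scale_leq// mulr_sumr.
by apply: eq_bigr => i _; rewrite coefZ nrmM.
Qed.

Lemma poly_norm1_cons p c : poly_norm1 (p * 'X + c%:P) = poly_norm1 p + nrm c.
Proof.
rewrite (@poly_norm1E _ (size p).+1); last first.
  rewrite (leq_trans (size_polyD _ _))// geq_max (leq_trans (size_polyC_leq1 _))// andbT.
  by rewrite (leq_trans (size_polyMleq _ _))// size_polyX addn2.
rewrite big_ord_recl coefD coefMX coefC/= add0r addrC; congr (_ + _).
by apply: eq_bigr => i _; rewrite coefD coefMX coefC/= addr0.
Qed.

Lemma poly_norm1C c : poly_norm1 c%:P = nrm c.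
Proof.
by have := poly_norm1_cons 0 c; rewrite mul0r add0r /poly_norm1 size_poly0 big_ord0 add0r.
Qed.

Lemma poly_norm1M p (q : {poly C}) : poly_norm1 (p * q) <= poly_norm1 p * poly_norm1 q.
Proof.
elim/poly_ind: p => [|p c ih].
  by rewrite mul0r -polyC0 poly_norm1C nrm0 mul0r.
rewrite mulrDl mul_polyC mulrAC (le_trans (poly_norm1D _ _))//.
have := poly_norm1_cons (p * q) 0; rewrite polyC0 addr0 nrm0 addr0 => ->.
by rewrite poly_norm1Z poly_norm1_cons mulrDl lerD2r.
Qed.

Lemma poly_norm1_prod n (f : 'I_n -> {poly C}) (M : 'I_n -> R) :
  (forall j, poly_norm1 (f j) <= M j) -> poly_norm1 (\prod_(j < n) f j) <= \prod_(j < n) M j.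
Proof.
elim: n f M => [|n ih] f M fM; first by rewrite !big_ord0 -polyC1 poly_norm1C nrm1.
rewrite !big_ord_recl (le_trans (poly_norm1M _ _))// ler_pM ?poly_norm1_ge0//.
exact: ih.
Qed.

Lemma bsum_coef p : bsum (fun i => nrm p`_i) (poly_norm1 p).
Proof.
apply: bsum_nat => [n|n]; first exact: nrm_ge0.
rewrite (@poly_norm1E p (maxn (size p) n)) ?leq_maxl//.
rewrite (big_ord_widen (maxn (size p) n) (fun i => nrm p`_i)) ?leq_maxr// big_mkcond/=.
by apply: ler_sum => i _; case: ifP => // _; exact: nrm_ge0.
Qed.

Lemma hassum_horner p (z : C) : hassum (fun i => p`_i * z ^+ i) p.[z].
Proof.
rewrite horner_coef -(sum_fset_iota (fun i => p`_i * z ^+ i)).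
apply: hassum_fset => i; rewrite !inE mem_iota /= -leqNgt => /(nth_default 0) ->.
by rewrite mul0r.
Qed.

(** By Fubini the sum is a power series in z with absolutely summable
   coefficients, and these coefficients are determined by its values near 0. *)
Lemma poly_series_eq0 (I : choiceType) (P : I -> {poly C}) (m : I -> R) (M delta : R) :
  0 < delta -> (forall i, poly_norm1 (P i) <= m i) -> bsum m M ->
  (forall z : C, nrm z < delta -> sum (fun i => (P i).[z]) = 0) ->
  sum (fun i => (P i).[1]) = 0.
Proof.
move=> d0 Pm mM P0.
have bP : bsum (fun p : I * nat => nrm (P p.1)`_p.2) M.
  apply: (bsum_pair (m := fun i => poly_norm1 (P i))) => [p|i|]; first exact: nrm_ge0.
    exact: (bsum_coef (P i)).
  exact: le_bsum mM.
pose h n := sum (fun i => (P i)`_n).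
have hh n : hassum (fun i => (P i)`_n) (h n).
  apply: (bsum_hassum_sum (M := M)).
  by apply: (bsum_inj (h := fun i => (i, n)) _ bP) => x y [].
have key (z : C) : nrm z <= 1 -> exists2 S, hassum (fun i => (P i).[z]) S &
    hassum (fun n => h n * z ^+ n) S.
  move=> z1; pose f (p : I * nat) := (P p.1)`_p.2 * z ^+ p.2.
  have bf : bsum (fun x => nrm (f x)) M.
    apply: le_bsum bP => p; rewrite nrmM nrmX ler_piMr ?nrm_ge0//.
    by rewrite exprn_ile1 ?nrm_ge0.
  have [] := @hassum_fubini_swap _ _ _ f (fun i => (P i).[z]) (fun n => h n * z ^+ n) M bf.
  - by move=> i; exact: (hassum_horner (P i) z).
  - by move=> n; rewrite mulrC; apply: eq_hassum (hassumZ (z ^+ n) (hh n)) => i; exact: mulrC.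
  - by move=> _.
have h0 : forall n, h n = 0.
  apply: (power_series_eq0 (K := M) (delta := Num.min delta 1)).
  - by rewrite lt_min d0 ltr01.
  - have bP' : bsum (fun p : nat * I => nrm (P p.2)`_p.1) M.
      by apply: (bsum_inj (h := fun x => (x.2, x.1)) _ bP) => -[? ?] [? ?] [-> ->].
    have [U hU] := bsum_hassum bP'.
    by have [] := hassum_fubini (g := h) bP' hU hh.
  - move=> z; rewrite lt_min => /andP[zd /ltW z1].
    have [S h1 h2] := key z z1; suff <- : S = 0 by [].
    by rewrite -(hassum_sum h1) P0.
have [|S h1 h2] := key 1; first by rewrite nrm1.
rewrite (hassum_sum h1); apply: hassum_unique h2 _.
have := @hassum_fset R nat (fun n => h n * 1 ^+ n) fset0; rewrite big_seq_fset0; apply => i _.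
by rewrite h0 mul0r.
Qed.

Variables (q : R) (d : nat).
Hypothesis q01 : 0 < q < 1.

(** On the line s0 + z v each term is a polynomial in z, whose l^1 norm is bounded
   by the majorant for the exponents |s0_j| + |v_j|. *)
Lemma gterm_line_eq0 (B : 'I_d -> nat -> C) (M : 'I_d -> R) (s0 v : 'rV[C]_d) (delta : R) :
  0 < delta -> (forall j n, nrm (B j n) <= M j) ->
  (forall z : C, nrm z < delta -> sum (gterm q B (s0 + z *: v)) = 0) ->
  sum (gterm q B (s0 + v)) = 0.
Proof.
move=> d0 BM g0.
have M0 j : 0 <= M j by apply: le_trans (nrm_ge0 _) (BM j 0%N).
pose sigma (j : 'I_d) := nrm (s0 0 j) + nrm (v 0 j).
have [N hN] := bsum_majorant q01 M0 (fun j => addr_ge0 (nrm_ge0 (s0 0 j)) (nrm_ge0 (v 0 j))).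
pose Q (j : 'I_d) (n : nat) : {poly C} :=
  (n`!%:R^-1) *: \prod_(i < n) (v 0 j *: 'X + (s0 0 j + i%:R)%:P).
pose P (r : d.-tuple nat) : {poly C} :=
  \prod_(j < d) (((q ^+ (j.+1 * tnth r j))%:C * B j (tailn j r)) *: Q j (tnth r j)).
have PE r (z : C) : (P r).[z] = gterm q B (s0 + z *: v) r.
  rewrite /P horner_prod; apply: eq_bigr => j _; rewrite hornerZ hornerZ horner_prod.
  rewrite /ris !mxE.
  have -> : \prod_(i < tnth r j) (v 0 j *: 'X + (s0 0 j + i%:R)%:P).[z] =
      \prod_(i < tnth r j) (s0 0 j + z * v 0 j + i%:R).
    by apply: eq_bigr => i _; rewrite hornerD hornerZ hornerX hornerC; ring.
  by ring.
have Pm r : poly_norm1 (P r) <= majorant q M sigma r.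
  apply: poly_norm1_prod => j; rewrite !poly_norm1Z nrmV nrm_nat nrmM nrm_real.
  rewrite ger0_norm ?(qpow_ge0 q01)// [_ * nrm (B _ _)]mulrC -mulrA.
  have h : poly_norm1 (\prod_(i < tnth r j) (v 0 j *: 'X + (s0 0 j + i%:R)%:P)) <=
      \prod_(i < tnth r j) (sigma j + i%:R).
    apply: poly_norm1_prod => i; rewrite -[v 0 j *: 'X]mul_polyC poly_norm1_cons poly_norm1C.
    by rewrite addrC /sigma addrAC lerD2r (le_trans (nrmD _ _))// nrm_nat.
  apply: ler_pM => //; first exact: nrm_ge0.
    by rewrite !mulr_ge0 ?(qpow_ge0 q01) ?poly_norm1_ge0// invr_ge0.
  rewrite mulrC; apply: ler_pM; rewrite ?(qpow_ge0 q01)//.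
  - by rewrite mulr_ge0 ?poly_norm1_ge0// invr_ge0.
  - by rewrite /ris mulrC ler_wpM2r ?invr_ge0.
  - by rewrite (qpow_le q01)// leq_pmull.
have := @poly_series_eq0 _ P _ N delta d0 Pm hN.
have e z : (fun r => (P r).[z]) = gterm q B (s0 + z *: v) by apply/funext => r; rewrite PE.
rewrite e scale1r; apply => z /g0; by rewrite e.
Qed.

End EntireOnLines.

(** * Germs along the polar hyperplanes *)

Section Germs.
Variables (R : realType) (q : R) (d : nat).
Hypothesis q01 : 0 < q < 1.
Local Notation C := R[i].
Local Notation V := ('rV[C]_d * 'rV[C]_d)%type.
Local Notation L := (pole_lattice q).
Local Notation P := (polar_locus q (d := d)).
Local Notation F := (fun p : V => fq_expansion q p.1 p.2).
Implicit Types (s t : 'rV[C]_d) (p x : V).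

Lemma tailD (j : 'I_d) t u : tail j (t + u) = tail j t + tail j u.
Proof. by rewrite /tail -big_split; apply: eq_bigr => i _; rewrite mxE. Qed.

Lemma tailZ (j : 'I_d) c t : tail j (c *: t) = c * tail j t.
Proof. by rewrite /tail mulr_sumr; apply: eq_bigr => i _; rewrite mxE. Qed.

Lemma nrm_tail (j : 'I_d) t : nrm (tail j t) <= d%:R * nrm t.
Proof.
rewrite (le_trans (nrm_sum _ _ _))//.
apply: (@le_trans _ _ (\sum_(i < d) nrm t)); last by rewrite sumr_const card_ord mulr_natl.
rewrite [leRHS](bigID (fun i : 'I_d => (j <= i)%N))/=.
rewrite -[leLHS]addr0 lerD ?sumr_ge0// => [|i _]; last exact: nrm_ge0.
by apply: ler_sum => i _; exact: nrm_entry.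
Qed.

Lemma tail_near (p x : V) (j : 'I_d) (e : R) : 0 < e ->
  nrm (x - p) < e / d.+1%:R -> nrm (tail j x.2 - tail j p.2) < e.
Proof.
move=> e0; rewrite ltr_pdivlMr// => h.
have -> : tail j x.2 - tail j p.2 = tail j (x - p).2.
  by rewrite -[(x - p).2]/(x.2 - p.2) -[in RHS]scaleN1r tailD tailZ mulN1r.
apply: le_lt_trans h; apply: le_trans (nrm_tail _ _) _; rewrite mulrC.
by apply: ler_pM; rewrite ?nrm_ge0 ?nrm_snd// ler_nat.
Qed.

Lemma holo_tail (j : 'I_d) x : holo x (fun y : V => tail j y.2).
Proof.
exists (fun h => tail j h.2); apply: (@linear_part_affine _ _ _ _ _ d%:R) => // [a u v|h|h].
- by rewrite tailD tailZ.
- by rewrite (le_trans (nrm_tail _ _))// ler_wpM2l// nrm_snd.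
- by rewrite tailD.
Qed.

Lemma holo_fst (j : 'I_d) x : holo x (fun y : V => y.1 0 j).
Proof.
exists (fun h : V => h.1 0 j); apply: (@linear_part_affine _ _ _ _ _ 1) => // [a u v|h|h].
- by rewrite !mxE.
- by rewrite mul1r (le_trans (nrm_entry _ _))// nrm_fst.
- by rewrite mxE.
Qed.

Lemma holo_snd (j : 'I_d) x : holo x (fun y : V => y.2 0 j).
Proof.
exists (fun h : V => h.2 0 j); apply: (@linear_part_affine _ _ _ _ _ 1) => // [a u v|h|h].
- by rewrite !mxE.
- by rewrite mul1r (le_trans (nrm_entry _ _))// nrm_snd.
- by rewrite mxE.
Qed.

(** The denominator of F near p: one linear factor for each of the polar
   hyperplanes through p. *)
Definition polar_factor p x : C :=
  \prod_(j < d | `[< L (tail j p.2) >]) (tail j x.2 - tail j p.2).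

Definition germ_kernel p (j : 'I_d) (n : nat) t : C :=
  rpowc q (j.+1%:R * t 0 j) * kernel q (tail j p.2) n (tail j t).

(** The product of F and polar_factor, extended to the polar locus near p. *)
Definition germ p x : C :=
  rpowc (1 - q) (\sum_(j < d) x.1 0 j) *
  sum (gterm q (fun j n => germ_kernel p j n x.2) x.1).

Lemma holo_rpowcM (x : V) (f : V -> C) (k : C) : holo x f -> holo x (fun y => rpowc q (k * f y)).
Proof.
move=> hf; apply: (holo_comp (g := fun y => k * f y)); last exact: holo_rpowc.
by apply: holoM => //; exact: holo_cst.
Qed.

(** Near p the tails of x meet the lattice only where those of p do, and all the
   kernels have bounds that are uniform in n; finitely many radii are involved. *)
Lemma germ_local p : exists2 e : R, 0 < e & forall x, nrm (x - p) < e ->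
  [/\ holo x (germ p) /\
      (forall j, ~ L (tail j x.2) -> forall n, germ_kernel p j n x.2 != 0),
      exists M : 'I_d -> R, forall j n, nrm (germ_kernel p j n x.2) <= M j,
      forall j : 'I_d, L (tail j x.2) -> L (tail j p.2) /\ tail j x.2 = tail j p.2 &
      ~ P x -> forall r, polar_factor p x * expansion_term q x.1 x.2 r =
        gterm q (fun j n => germ_kernel p j n x.2) x.1 r].
Proof.
have [e1 e10 h1] : exists2 e : R, 0 < e & forall j : 'I_d, forall z,
    nrm (z - tail j p.2) < e ->
  (exists rho M, 0 < rho /\ forall n, jetN rho z (kernel q (tail j p.2) n) M) /\
  (~ L z -> forall n, kernel q (tail j p.2) n z != 0 /\
    kernel q (tail j p.2) n z =
      (if `[< L (tail j p.2) >] then z - tail j p.2 else 1) / (1 - rpowc q (n%:R + z))).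
  apply: exists_common => [j e e' /andP[_ ee] H z hz|j].
    by apply: H; apply: lt_le_trans ee.
  exact: kernel_near.
have [e2 e20 h2] : exists2 e : R, 0 < e & forall j : 'I_d, forall z,
    nrm (z - tail j p.2) < e -> L z -> L (tail j p.2) /\ z = tail j p.2.
  apply: exists_common => [j e e' /andP[_ ee] H z hz|j].
    by apply: H; apply: lt_le_trans ee.
  exact: lattice_isolated.
exists (Num.min e1 e2 / d.+1%:R); first by rewrite divr_gt0// lt_min e10.
move=> x hx.
have m0 : 0 < Num.min e1 e2 by rewrite lt_min e10.
have near j : nrm (tail j x.2 - tail j p.2) < e1 /\ nrm (tail j x.2 - tail j p.2) < e2.
  by have := tail_near j m0 hx; rewrite lt_min => /andP.
have jets j : exists rho M, 0 < rho /\
    forall n, jetN rho x (fun y : V => germ_kernel p j n y.2) M.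
  have [[rho [M [r0 jM]]] _] := h1 j _ (near j).1.
  have [Lt [r2 [w2 j2]]] := holo_tail j x.
  have [s s0 hs] := jet_small r0 j2.
  have [r3 [M3 [r30 j3]]] := holo_jetN (holo_rpowcM j.+1%:R (holo_snd j x)).
  have s0' : 0 < s by case/andP: s0.
  have [k1 k2] := min_shrink s0' r30.
  exists (Num.min s r3), (M3 * M); split; first by case/andP: k1.
  move=> n; apply: jetNM; first exact: jetN_shrink k2 j3.
  have [Lk [w [jk kM]]] := jM n.
  exists (fun h => Lk (Lt h)), w; split=> //.
  exact: jet_comp (lexx _) (hs _ k1) jk.
split.
- split; last first.
    by move=> j nL n; have [h _] := (h1 j _ (near j).1).2 nL n; rewrite mulf_neq0 ?rpowc_neq0.
  apply: holoM; last exact: gterm_sum_holo.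
  have -> : (fun y : V => rpowc (1 - q) (\sum_(j < d) y.1 0 j)) =
      fun y => cexp ((ln (1 - q))%:C * \sum_(j < d) y.1 0 j).
    by apply/funext => y; rewrite rpowcE.
  apply: (holo_comp (g := fun y : V => (ln (1 - q))%:C * \sum_(j < d) y.1 0 j)) (holo_cexp _).
  apply: holoM; first exact: holo_cst.
  by apply: holo_sum => j _; exact: holo_fst.
- have /choice[M hM] : forall j, exists M, forall n, nrm (germ_kernel p j n x.2) <= M.
    by move=> j; have [rho [M [_ jM]]] := jets j; exists M => n; exact: (jetN_bound (jM n)).
  by exists M.
- by move=> j; apply: h2; exact: (near j).2.
move=> nP r; have nL j : ~ L (tail j x.2) by move=> h; apply: nP; exists j.
have hk j := (h1 j _ (near j).1).2 (nL j).
rewrite expansion_termE// /polar_factor big_mkcond/= -big_split/=.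
apply: eq_bigr => j _; rewrite /germ_kernel (hk j _).2.
set u := (1 - _)^-1; set w := (if _ then _ else _); ring.
Qed.

Lemma polar_factor1 p : ~ P p -> forall x, polar_factor p x = 1.
Proof.
move=> nP x; rewrite /polar_factor big_pred0// => j.
by apply/asboolP => h; apply: nP; exists j.
Qed.

Lemma bsum_expansion s t : ~ P (s, t) ->
  exists M, bsum (fun r => nrm (expansion_term q s t r)) M.
Proof.
move=> nP; have [e e0 /(_ (s, t))] := germ_local (s, t).
rewrite subrr nrm0 => /(_ e0)[_ [M hM] _ /(_ nP) h].
have [N hN] := bsum_gterm q01 s hM; exists N; apply: le_bsum hN => r.
by have := h r; rewrite polar_factor1// mul1r => /= ->.
Qed.

Lemma germE p : exists2 e : R, 0 < e & forall x, nrm (x - p) < e -> ~ P x ->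
  F x * polar_factor p x = germ p x.
Proof.
have [e e0 he] := germ_local p; exists e => // -[s t] /he[_ _ _ h] /[dup] nP /h h1.
have [M hM] := bsum_expansion nP; have [S hS] := bsum_hassum hM.
rewrite /germ /fq_expansion /= (hassum_sum hS) -mulrA; congr (_ * _).
rewrite mulrC; apply/esym/hassum_sum.
by apply: eq_hassum (hassumZ _ hS) => r; exact: h1.
Qed.

(** The entries are differences of consecutive tails, so that the tails can be
   prescribed: moving along this vector leaves exactly the hyperplanes with an
   index j such that b j holds. *)
Definition direction (b : nat -> bool) : 'rV[C]_d :=
  \row_(i < d) ((b i && (i < d)%N)%:R - (b i.+1 && (i.+1 < d)%N)%:R).

Lemma tail_direction b (j : 'I_d) : tail j (direction b) = (b j)%:R.
Proof.
pose tau i : C := (b i && (i < d)%N)%:R.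
rewrite /tail (eq_bigr (fun i : 'I_d => - tau i.+1 - - tau i)); last first.
  by move=> i _; rewrite mxE opprK addrC.
rewrite -(big_geq_mkord j d xpredT (fun i => - tau i.+1 - - tau i)).
rewrite telescope_sumr; last exact: ltnW.
by rewrite /tau ltnn andbF ltn_ord andbT mulr0n oppr0 opprK add0r.
Qed.

Definition shift_snd p (z : C) b : V := p + z *: (0, direction b).

Lemma nrm_shift_snd p z b : nrm (shift_snd p z b - p) = nrm z * nrm ((0, direction b) : V).
Proof. by rewrite /shift_snd addrC addKr nrmZ. Qed.

Lemma tail_shift_snd p z b (j : 'I_d) : tail j (shift_snd p z b).2 = tail j p.2 + z * (b j)%:R.
Proof. by rewrite [(shift_snd _ _ _).2]/(p.2 + z *: direction b) tailD tailZ tail_direction. Qed.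

Lemma small_scalar (V' : normedModType C) (v : V') (e : R) : 0 < e ->
  exists2 z : R, 0 < z & nrm (z%:C : C) * nrm v < e.
Proof.
move=> e0; have n0 : 0 < nrm v + 1 by rewrite ltr_wpDl ?nrm_ge0.
exists (e / (nrm v + 1)); first by rewrite divr_gt0.
rewrite nrm_real gtr0_norm ?divr_gt0// mulrAC ltr_pdivrMr// ltr_pM2l//.
by rewrite ltrDl.
Qed.

Lemma realC_neq0 (z : R) : 0 < z -> z%:C != 0 :> C.
Proof. by move=> z0; rewrite -nrm_gt0 nrm_real gtr0_norm. Qed.

Lemma off_polar_near p (e : R) : 0 < e -> exists2 x : V, nrm (x - p) < e & ~ P x /\
  polar_factor p x != 0.
Proof.
move=> e0; have [e1 e10 h1] := germ_local p.
pose b (i : nat) := true.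
have m0 : 0 < Num.min e e1 by rewrite lt_min e0.
have [z z0] := small_scalar ((0, direction b) : V) m0.
rewrite -(nrm_shift_snd p) lt_min => /andP[xe xe1].
exists (shift_snd p z%:C b) => //; have [_ _ h _] := h1 _ xe1.
split.
  move=> [j /h[_]]; rewrite tail_shift_snd mulr1 => /eqP.
  by rewrite -subr_eq0 addrC addKr (negbTE (realC_neq0 z0)).
apply/prodf_neq0 => j _; rewrite tail_shift_snd mulr1 addrC addKr.
exact: realC_neq0.
Qed.

Lemma ris_delta (j0 : 'I_d) (r : d.-tuple nat) :
  (exists2 j, j != j0 & tnth r j != 0%N) -> forall B : 'I_d -> nat -> C,
  gterm q B (delta_mx 0 j0) r = 0.
Proof.
move=> [j jj rj] B; rewrite /gterm (bigD1 j)//= mxE eqxx (negbTE jj)/=.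
by case: (tnth r j) rj => // n _; rewrite ris_at0 !mul0r.
Qed.

(** Suppose that the germ vanishes on the hyperplane near p. For a point t of the
   hyperplane close to p.2, and on no other polar hyperplane, the sum vanishes
   for all s near p.1, hence by the identity theorem for all s. But at
   s = (0, .., 1, .., 0) the binomial coefficients leave only r_j0 free, and the
   kernel with index j0 leaves only one value of r_j0: a single term survives,
   and it is not zero. *)
Lemma germ_nonvanishing p (j0 : 'I_d) : L (tail j0 p.2) ->
  ~ (\forall x \near p, tail j0 x.2 = tail j0 p.2 -> germ p x = 0).
Proof.
move=> Lj /nbhs_nrm[e e0 he].
have [e1 e10 h1] := germ_local p.
pose b (i : nat) := i != j0 :> nat.
have m0 : 0 < Num.min e e1 / 2 by rewrite divr_gt0// lt_min e0.
have [z z0] := small_scalar ((0, direction b) : V) m0.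
rewrite -(nrm_shift_snd p); set x0 := shift_snd p z%:C b => x0m.
pose t := x0.2.
have tj : tail j0 t = tail j0 p.2 by rewrite tail_shift_snd /b eqxx mulr0 addr0.
have x1 : x0.1 = p.1 by rewrite /x0 /= scaler0 addr0.
have m2 : Num.min e e1 / 2 < Num.min e e1.
  by rewrite ltr_pdivrMr// ltr_pMr ?ltr1n// lt_min e0.
have x0e1 : nrm (x0 - p) < e1.
  by rewrite (lt_trans x0m)// (lt_le_trans m2)// ge_min lexx orbT.
have [[_ hker] [M hM] hiso _] := h1 _ x0e1.
pose B j n := germ_kernel p j n t.
have tn j : j != j0 -> ~ L (tail j t).
  move=> jj /hiso[_]; rewrite tail_shift_snd /b -[(j == _ :> nat)]/(j == j0) jj mulr1 => /eqP.
  by rewrite -subr_eq0 addrC addKr (negbTE (realC_neq0 z0)).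
pose v : 'rV[C]_d := delta_mx 0 j0 - p.1.
have [delta d0 hd] : exists2 delta : R, 0 < delta & forall w : C, nrm w < delta ->
    nrm w * nrm ((v, 0) : V) < Num.min e e1 / 2.
  have n0 : 0 < nrm ((v, 0) : V) + 1 by rewrite ltr_wpDl ?nrm_ge0.
  exists (Num.min e e1 / 2 / (nrm ((v, 0) : V) + 1)); first by rewrite divr_gt0.
  move=> w; rewrite ltr_pdivlMr//; apply: le_lt_trans.
  by rewrite ler_wpM2l ?nrm_ge0// lerDl.
(* the line from p.1 to the vector s = (0, .., 1, .., 0) *)
have := @gterm_line_eq0 R q d q01 B M p.1 v delta d0 hM.
rewrite addrC subrK => h0.
have {h0} : sum (gterm q B (delta_mx 0 j0)) = 0.
  apply: h0 => w /hd hw.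
  have := he (p.1 + w *: v, t); rewrite tj => /(_ _ erefl).
  have -> : nrm ((p.1 + w *: v, t) - p) < e.
    have -> : ((p.1 + w *: v, t) : V) - p = (x0 - p) + w *: (v, 0).
      rewrite -[LHS]/(p.1 + w *: v - p.1, t - p.2).
      rewrite -[RHS]/(x0.1 - p.1 + w *: v, t - p.2 + w *: 0) x1 subrr add0r.
      by rewrite scaler0 addr0 addrC addKr.
    rewrite (le_lt_trans (nrmD _ _))// nrmZ (lt_le_trans (ltrD x0m hw))//.
    by rewrite -splitr ge_min lexx.
  move=> /(_ isT)/eqP; rewrite /germ mulf_eq0 rpowcE (negbTE (cexp_neq0 _))/=.
  by move=> /eqP.
(* the only index r_j0 for which the kernel does not vanish on the hyperplane *)
have /pole_latticeP[//|n0 hn0] := Lj.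
pose r0 : d.-tuple nat := [tuple if j == j0 then n0 else 0%N | j < d].
have tailr (r : d.-tuple nat) : (forall j, j != j0 -> tnth r j = 0%N) ->
    tailn j0 r = tnth r j0.
  move=> h; rewrite /tailn (bigD1 j0)//= big1 ?addn0// => j /andP[_]; exact: h.
have r00 j : j != j0 -> tnth r0 j = 0%N by move=> jj; rewrite tnth_mktuple (negbTE jj).
have r0j : tnth r0 j0 = n0 by rewrite tnth_mktuple eqxx.
have h1s : hassum (gterm q B (delta_mx 0 j0)) (gterm q B (delta_mx 0 j0) r0).
  apply: hassum1 => r rr.
  have [/existsP[j /andP[j1 j2]]|] := boolP [exists j, (j != j0) && (tnth r j != 0%N)].
    by apply: ris_delta; exists j.
  rewrite negb_exists => /forallP hr.
  have rz j : j != j0 -> tnth r j = 0%N.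
    by move=> jj; have := hr j; rewrite jj negbK => /eqP.
  have rn : tnth r j0 != n0.
    apply: contra_neq rr => rn; apply: eq_from_tnth => j.
    by have [->|jj] := eqVneq j j0; rewrite ?rn ?r0j// rz// r00.
  rewrite /gterm (bigD1 j0)//= tailr// /B /germ_kernel tj kernel_center//.
  case: eqP => [hr0|_]; last by rewrite !mulr0 mul0r.
  by move: rn; rewrite (lattice_index_unique q01 hr0 hn0) eqxx.
rewrite (hassum_sum h1s) => /eqP; apply/negP/prodf_neq0 => j _.
have q0 : 0 < q by case/andP: q01.
rewrite mulf_neq0//; last first.
  rewrite mulf_neq0 ?rpowc_neq0//.
  have [->|jj] := eqVneq j j0.
    rewrite tailr// r0j tj kernel_center// hn0 eqxx.
    have [dd dd0 /(_ 0)] := regular_part_near0 q01.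
    by rewrite nrm0 => /(_ dd0)[].
  by have := hker j (tn j jj) (tailn j r0); rewrite /germ_kernel mulf_eq0 negb_or => /andP[].
rewrite mulf_neq0//; last by apply: realC_neq0; rewrite exprn_gt0.
rewrite mxE eqxx/=; have [->|jj] := eqVneq j j0.
  by rewrite ris_at1 oner_eq0.
by rewrite r00// ris0 oner_eq0.
Qed.

Lemma holo_polar_factor p x : holo x (polar_factor p).
Proof.
apply: holo_prod => j _; apply: holoD; [exact: holo_tail|exact: holo_cst].
Qed.

End Germs.

(** * Meromorphic continuation and poles *)

Section Continuity.
Variable R : realType.
Local Notation C := R[i].
Variable V : normedModType C.

Lemma continuous_nrm (f : V -> C) (x : V) (e : R) : {for x, continuous f} -> 0 < e ->
  exists2 r : R, 0 < r & forall y, nrm (y - x) < r -> nrm (f y - f x) < e.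
Proof.
move=> /cvgrPdist_lt/(_ e%:C); rewrite ltcR => h /h /nbhs_nrm[r r0 hr].
by exists r => // y /hr; rewrite distrC -nrmE ltcR.
Qed.

(** Extends identities from the complement of the polar locus, which is dense. *)
Lemma eq_of_near (f g : V -> C) (x : V) :
  {for x, continuous f} -> {for x, continuous g} ->
  (forall e : R, 0 < e -> exists2 y, nrm (y - x) < e & f y = g y) -> f x = g x.
Proof.
move=> fc gc h; apply: eq_of_nrm_small => e e0.
have e2 : 0 < e / 2 by rewrite divr_gt0.
have [r1 r10 h1] := continuous_nrm fc e2; have [r2 r20 h2] := continuous_nrm gc e2.
have [|y] := h (Num.min r1 r2); first by rewrite lt_min r10.
rewrite lt_min => /andP[/h1 y1 /h2 y2] fg.
rewrite (le_lt_trans (nrmD3 (f y) _ _))// [ltRHS]splitr ltrD//; first by rewrite nrmC.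
by rewrite fg.
Qed.

End Continuity.

Theorem proposition2p2 (R : realType) (q : R) (d : nat) :
  0 < q < 1 -> (0 < d)%N ->
  let F := fun p : 'rV[R[i]]_d * 'rV[R[i]]_d => fq_expansion q p.1 p.2 in
  let P := polar_locus q (d := d) in
  [/\ forall s t : 'rV[R[i]]_d, conv_region t ->
        absolutely_convergent (fq_term q s t),
      forall s t : 'rV[R[i]]_d, ~ P (s, t) ->
        absolutely_convergent (expansion_term q s t),
      forall s t : 'rV[R[i]]_d, conv_region t ->
        fq q s t = fq_expansion q s t,
      meromorphic F P &
      poles F P = P /\
      simple_poles (fun (j : 'I_d) p => tail j p.2) (pole_lattice q) F].
Proof.
move=> q01 _ F P.
have hol (p : 'rV[R[i]]_d * 'rV[R[i]]_d) : holomorphic_near (germ q p) p.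
  have [e e0 he] := germ_local q01 p; apply/nbhs_nrm; exists e => // x /he[[h _] _ _ _].
  exact: holo_differentiable h.
have Fgerm (p : 'rV[R[i]]_d * 'rV[R[i]]_d) :
  \forall x \near p, ~ P x -> F x * polar_factor q p x = germ q p x.
  by have [e e0 he] := germE q01 p; apply/nbhs_nrm; exists e.
have openP p : ~ P p -> \forall x \near p, ~ P x.
  move=> nP; have [e e0 he] := germ_local q01 p; apply/nbhs_nrm; exists e => // x.
  by move=> /he[_ _ h _] [j /h[Lj _]]; apply: nP; exists j.
have Fgerm1 p : ~ P p -> \forall x \near p, F x = germ q p x.
  move=> nP; near=> x; have nPx : ~ P x by near: x; exact: openP.
  rewrite -[LHS]mulr1 -(polar_factor1 nP x); move: nPx; near: x; exact: Fgerm.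
split.
- move=> s t tC; have [[M hM] _] := fq_identity q01 s tC.
  exact: absolutely_convergent_bsum hM.
- move=> s t nP; have [M hM] := bsum_expansion q01 nP.
  exact: absolutely_convergent_bsum hM.
- by move=> s t tC; have [_] := fq_identity q01 s tC.
- split.
  + move=> p clP; apply: contrapT => /openP/clP[x [Px nPx]]; exact: nPx.
  + move=> p nP; have [e e0 he] := germ_local q01 p.
    have /nbhs_nrm[e1 e10 h1] := Fgerm1 p nP.
    have [|[hg _] _ _ _] := he p; first by rewrite subrr nrm0.
    apply: holo_differentiable; apply: holo_eq hg.
    by exists e1 => // y /h1.
  + move=> p; exists (germ q p), (polar_factor q p); split.
    * exact: hol.
    * by near=> x; apply: holo_differentiable; exact: holo_polar_factor.
    * move=> /nbhs_nrm[e e0 he]; have [x xe [_]] := off_polar_near q01 p e0.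
      by rewrite he// eqxx.
    * have [e e0 he] := germ_local q01 p; have /nbhs_nrm[e1 e10 h1] := Fgerm p.
      apply/nbhs_nrm; exists (Num.min e e1); first by rewrite lt_min e0.
      move=> x; rewrite lt_min => /andP[/he[_ _ iso _] /h1 xF] fx.
      have nP : ~ P x.
        move=> [j /iso[Lj xj]]; move: fx => /prodf_neq0/(_ j).
        by rewrite asboolT// xj subrr eqxx => /(_ isT).
      by split=> //; rewrite -(xF nP) mulfK.
have nonv p j := @germ_nonvanishing R q d q01 p j.
split; last first.
  move=> p; exists (germ q p); split; first exact: hol.
    exact: Fgerm.
  by move=> j Lj; exact: nonv.
apply/seteqP; split=> p.
  move=> h; apply: contrapT => nP; apply: h; exists (germ q p); split; first exact: hol.
  by near=> x => _; near: x; exact: Fgerm1.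
move=> [j Lj] [g [/nbhs_nrm[e1 e10 hg] /nbhs_nrm[e2 e20 gF]]].
apply: (nonv p j Lj).
have /nbhs_nrm[e3 e30 h3] := Fgerm p; have /nbhs_nrm[e4 e40 h4] := hol p.
(* a holomorphic extension g would give germ = g * polar_factor near p, also on
   the hyperplane, where polar_factor vanishes *)
pose e := Num.min (Num.min e1 e2) (Num.min e3 e4).
apply/nbhs_nrm; exists e; first by rewrite !lt_min e10 e20 e30.
move=> x xe xj; have := xe; rewrite !lt_min => /andP[/andP[x1 x2] /andP[x3 x4]].
have fx : polar_factor q p x = 0.
  by rewrite /polar_factor (bigD1 j)/= ?asboolT// xj subrr mul0r.
rewrite -[RHS](mulr0 (g x)) -fx.
apply: (eq_of_near (f := germ q p) (g := fun y => g y * polar_factor q p y)).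
- apply: differentiable_continuous; exact: h4.
- apply: cvgM; apply: differentiable_continuous; first exact: hg.
  by apply: holo_differentiable; exact: holo_polar_factor.
move=> r r0; have m0 : 0 < Num.min r (e - nrm (x - p)) by rewrite lt_min r0 subr_gt0.
have [y yx [nPy _]] := off_polar_near q01 x m0.
move: yx; rewrite lt_min ltrBrDr => /andP[yr ye]; exists y => //.
have := le_lt_trans (nrmD3 x y p) ye; rewrite !lt_min => /andP[/andP[_ y2] /andP[y3 _]].
by rewrite -h3// gF.
Unshelve. all: by end_near. Qed.
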